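(* Let $s\in\mathbb{R}$ and let $K$ be the Airy operator on $(s,\infty)$, that is, the integral operator $(Kf)(x)=\int_s^\infty K(x,y)f(y)\,dy$ with kernel $K(x,y)=\frac{A(x)A'(y)-A'(x)A(y)}{x-y}$, where $A(x)=\sqrt\lambda\,\mathrm{Ai}(x)$ and $\lambda$ is a parameter. Then $K$ commutes with the differential operator $L$ given by $$Lf(x)=\big((x-s)f'(x)\big)'-x(x-s)f(x).$$
   Context: $\mathrm{Ai}$ is the Airy function, $\mathrm{Ai}''(x)=x\,\mathrm{Ai}(x)$, $\mathrm{Ai}(x)\to0$ as $x\to+\infty$. The kernel $K(x,y)$ is extended by continuity to $x=y$. Commutation, $KL=LK$, is understood in the sense of integration by parts on $(s,\infty)$, for functions with appropriate vanishing at $+\infty$ (no specific function class is fixed). *)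

(* Defs.v *)
From Stdlib Require Import Reals.
From Coquelicot Require Import Coquelicot.

Open Scope R_scope.

(* Complex-valued functions of a real variable are handled as functions into
   the real normed module C_R_NormedModule, so that [lambda] may be any complex
   number. *)

(* The improper Riemann integral
     Ai x = 1/PI * lim_(T -> +oo) int_0^T cos (t^3/3 + x t) dt,
   which is only conditionally convergent. *)
Definition Ai (x : R) : R :=
  / PI * RInt_gen (V := R_CompleteNormedModule)
           (fun t => cos (t ^ 3 / 3 + x * t)) (at_point 0) (Rbar_locally p_infty).

(* Total, like [Derive]: meaningful where [g] is differentiable. *)
Definition DeriveRC (g : R -> C) (x : R) : C :=
  (Derive (fun t => Re (g t)) x, Derive (fun t => Im (g t)) x).

Definition ex_deriveRC (g : R -> C) (x : R) : Prop :=
  ex_derive (K := R_AbsRing) (V := C_R_NormedModule) g x.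

(* Limit at [x] over the punctured neighbourhood of [x]. *)
Definition LimRC (g : R -> C) (x : R) : C :=
  (real (Lim (fun t => Re (g t)) x), real (Lim (fun t => Im (g t)) x)).

(* [mu] is a square root of lambda. *)
Definition airyA (mu : C) (x : R) : C := (mu * RtoC (Ai x))%C.

Definition airy_quotient (mu : C) (x y : R) : C :=
  ((airyA mu x * DeriveRC (airyA mu) y - DeriveRC (airyA mu) x * airyA mu y)
   / RtoC (x - y))%C.

(* On the diagonal: extension by continuity. *)
Definition airy_kernel (mu : C) (x y : R) : C :=
  if Req_EM_T x y then LimRC (fun z => airy_quotient mu x z) x
  else airy_quotient mu x y.

(* Improper at both ends: f may be singular at s. *)
Definition ex_int_half_line (s : R) (g : R -> C) : Prop :=
  ex_RInt_gen (V := C_R_NormedModule) g (at_right s) (Rbar_locally p_infty).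

Definition int_half_line (s : R) (g : R -> C) : C :=
  RInt_gen (V := C_R_CompleteNormedModule) g (at_right s) (Rbar_locally p_infty).

Definition airy_op (s : R) (mu : C) (f : R -> C) (x : R) : C :=
  int_half_line s (fun y => (airy_kernel mu x y * f y)%C).

Definition airy_diff_op (s : R) (f : R -> C) (x : R) : C :=
  (DeriveRC (fun t => RtoC (t - s) * DeriveRC f t) x
   - RtoC (x * (x - s)) * f x)%C.

(* The functions f on (s, +oo) for which the integrations by parts make sense:
   f is C^2 on the open half-line; the boundary term (x - s) f'(x) vanishes at s
   (automatic when f is C^1 up to s); and f, f' grow at most exponentially at
   +oo.  As Ai and Ai' decay faster than every exponential, the last condition
   makes the boundary terms at +oo vanish; the case a = 0 contains all f with
   f, f' -> 0. *)
Record admissible (s : R) (f : R -> C) : Prop := {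
  adm_derive1 : forall x, s < x -> ex_deriveRC f x;
  adm_derive2 : forall x, s < x -> ex_deriveRC (DeriveRC f) x;
  adm_continuous2 : forall x, s < x ->
    continuous (U := C_R_NormedModule) (DeriveRC (DeriveRC f)) x;
  adm_left : filterlim (fun x => (RtoC (x - s) * DeriveRC f x)%C)
    (at_right s) (locally (T := C_R_NormedModule) (RtoC 0));
  adm_infty : exists a M : R, Rbar_locally p_infty (fun x =>
    Cmod (f x) <= M * exp (a * x) /\ Cmod (DeriveRC f x) <= M * exp (a * x))
}.

(* Main.v *)
Require Import Defs.
From Stdlib Require Import Reals Lra.
From Coquelicot Require Import Coquelicot.

Open Scope R_scope.

(** Shifting the contour of the Airy integral to Im z = eta > 0 makes it
    absolutely convergent and shows that Ai and Ai' decay faster than any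
    exponential and that Ai'' = x Ai.  With
    k(x,y) = int_0^oo Ai(x+t) Ai(y+t) dt, the Airy kernel is lambda k(x,y), also on
    the diagonal, because (x-y) Ai(x+t) Ai(y+t) is the t-derivative of
    W(t) = Ai'(x+t) Ai(y+t) - Ai(x+t) Ai'(y+t).  Similarly
    L_x k - L_y k = int_0^oo (t W(t))' dt = 0.  Two integrations by parts move L
    from f to the kernel, and L_y k = L_x k leaves L applied to K f. *)

(** * Dominated integrals over a half-line *)

(** Every analytic step is reduced to a pointwise bound by a multiple of one explicit function,
    [weight], of total mass 1. Such a bound gives convergence at both ends, a bound for the integral
    and, applied to a second-order Taylor remainder, differentiation under the integral sign; the
    price is one derivative more than is computed. The weight has to be singular at s: admissibility
    controls only (x - s) f'(x) there, so f may be unbounded near s. The height eta of the contour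
    stays free: height eta yields decay like exp (- eta x), and only all heights together beat the
    exponential growth of f, whose rate is arbitrary. The leading coefficient x - s of L makes the
    boundary terms at s vanish, and s itself cancels from L_x k - L_y k because (x - s) - (y - s) =
    x - y. Nothing bounds f'', so the convergence of K (L f) is not obtained by domination; the
    integration by parts itself supplies it. *)

Lemma filterlim_0_eps {T : Type} (F : (T -> Prop) -> Prop) {FF : Filter F} (g : T -> R) :
  (forall eps : posreal, F (fun t => Rabs (g t) <= eps)) -> filterlim g F (locally 0).
Proof.
  intros H. apply filterlim_locally. intros eps.
  assert (he : 0 < eps / 2) by (destruct eps; simpl; lra).
  apply (filter_imp _ _) with (2 := H (mkposreal _ he)). simpl.
  intros t ht. unfold ball; simpl; unfold AbsRing_ball, abs, minus, plus, opp; simpl.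
  destruct eps as [e hpos]; simpl in *.
  replace (g t + - 0) with (g t) by ring. lra.
Qed.

Lemma filterlim_0_abs {T : Type} (F : (T -> Prop) -> Prop) {FF : Filter F} (g : T -> R) :
  filterlim g F (locally 0) -> forall eps, 0 < eps -> F (fun t => Rabs (g t) < eps).
Proof.
  intros H eps he.
  generalize (proj1 (filterlim_locally g 0) H (mkposreal _ he)).
  apply filter_imp. intros t ht.
  unfold ball in ht; simpl in ht; unfold AbsRing_ball, abs, minus, plus, opp in ht; simpl in ht.
  now replace (g t) with (g t + - 0) by ring.
Qed.

Lemma filterlim_0_squeeze {T : Type} (F : (T -> Prop) -> Prop) {FF : Filter F} (g h : T -> R) :
  F (fun t => Rabs (g t) <= Rabs (h t)) -> filterlim h F (locally 0) -> filterlim g F (locally 0).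
Proof.
  intros H1 H2. apply filterlim_0_eps; [exact FF|]. intros eps.
  generalize (filter_and _ _ H1 (filterlim_0_abs F h H2 eps (cond_pos eps))).
  apply filter_imp. intros t [h1 h2]. lra.
Qed.

Lemma at_right_gt (s : R) : at_right s (fun t => s < t).
Proof. exists (mkposreal 1 Rlt_0_1). intros y _ h. exact h. Qed.

Lemma at_right_lt (s c : R) : s < c -> at_right s (fun t => s < t < c).
Proof.
  intros h. assert (h' : 0 < c - s) by lra. exists (mkposreal _ h'). intros y hb hy.
  unfold ball in hb; simpl in hb; unfold AbsRing_ball, abs, minus, plus, opp in hb; simpl in hb.
  apply Rabs_def2 in hb. lra.
Qed.

Lemma p_infty_gt (s : R) : Rbar_locally p_infty (fun t => s < t).
Proof. exists s. auto. Qed.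

Lemma is_RInt_gen_half_ext {V : NormedModule R_AbsRing} (s : R) (f g : R -> V) (l : V) :
  (forall y, s < y -> f y = g y) ->
  is_RInt_gen f (at_right s) (Rbar_locally p_infty) l ->
  is_RInt_gen g (at_right s) (Rbar_locally p_infty) l.
Proof.
  intros h. apply is_RInt_gen_ext.
  apply (Filter_prod _ _ _ (fun t => s < t) (fun t => s < t)); [apply at_right_gt|apply p_infty_gt|].
  intros a b ha hb y hy; simpl in hy. apply h.
  apply Rlt_trans with (2 := proj1 hy). now apply Rmin_glb_lt.
Qed.

(** The boundary values are limits of the primitive, which allows [g] to be unbounded at [s]. The
    integral identities below all rest on this with an explicit primitive. *)
Lemma is_RInt_gen_primitive (s : R) (g P : R -> R) (la lb : R) :
  (forall t, s < t -> continuous g t) -> (forall t, s < t -> is_derive P t (g t)) ->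
  filterlim P (at_right s) (locally la) -> filterlim P (Rbar_locally p_infty) (locally lb) ->
  is_RInt_gen g (at_right s) (Rbar_locally p_infty) (lb - la).
Proof.
  intros hg hP ha hb. unfold is_RInt_gen.
  apply (filterlimi_lim_ext_loc (fun ab => P (snd ab) - P (fst ab))).
  - apply (Filter_prod _ _ _ (fun t => s < t) (fun t => s < t)).
    + apply at_right_gt.
    + apply p_infty_gt.
    + intros a b h1 h2; simpl.
      apply (is_RInt_derive (V := R_CompleteNormedModule) P g a b);
        intros t ht; [apply hP|apply hg];
        apply Rlt_le_trans with (2 := proj1 ht); apply Rmin_glb_lt; assumption.
  - apply (filterlim_comp_2 (G := locally lb) (H := locally (- la))
      (fun ab => P (snd ab)) (fun ab => - P (fst ab)) Rplus).
    + apply (filterlim_comp _ _ _ snd P _ _ _ filterlim_snd hb).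
    + apply (filterlim_comp _ _ _ (fun ab : R * R => P (fst ab)) Ropp _ (locally la)).
      * apply (filterlim_comp _ _ _ fst P _ _ _ filterlim_fst ha).
      * apply (filterlim_opp (V := R_NormedModule)).
    + apply (filterlim_plus (V := R_NormedModule)).
Qed.

(* The derivative of [- / (1 + sqrt (t - s))], chosen for its elementary primitive: it
   dominates exponentially decaying functions with a singularity (t - s)^(-1/2) at s. *)
Definition weight (s t : R) : R := / (2 * sqrt (t - s) * (1 + sqrt (t - s)) ^ 2).

Definition weight_int (s t : R) : R := - / (1 + sqrt (t - s)).

Lemma weight_pos (s t : R) : s < t -> 0 < weight s t.
Proof.
  intros h. unfold weight. apply Rinv_0_lt_compat.
  assert (0 < sqrt (t - s)) by (apply sqrt_lt_R0; lra). nra.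
Qed.

Lemma is_derive_weight_int (s t : R) : s < t -> is_derive (weight_int s) t (weight s t).
Proof.
  intros h. assert (h0 : 0 < sqrt (t - s)) by (apply sqrt_lt_R0; lra).
  unfold weight_int, weight. auto_derive; change (t + - s) with (t - s).
  - repeat split; lra.
  - field. lra.
Qed.

Lemma continuous_weight (s t : R) : s < t -> continuous (weight s) t.
Proof.
  intros h. assert (h0 : 0 < sqrt (t - s)) by (apply sqrt_lt_R0; lra).
  apply (ex_derive_continuous (K := R_AbsRing) (V := R_NormedModule)).
  unfold weight. auto_derive. change (t + - s) with (t - s). repeat split; try lra. nra.
Qed.

Lemma weight_int_right (s : R) : filterlim (weight_int s) (at_right s) (locally (-1)).
Proof.
  replace (-1) with (weight_int s s).
  2:{ unfold weight_int. replace (s - s) with 0 by ring. rewrite sqrt_0. field. }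
  apply (filterlim_filter_le_1 (F := locally s) (G := at_right s)).
  - intros P [e H]. exists e. intros y hy _. now apply H.
  - apply continuity_pt_filterlim. unfold weight_int.
    apply continuity_pt_opp, continuity_pt_inv.
    + apply continuity_pt_plus; [apply continuity_pt_const; intros ? ?; reflexivity|].
      apply (continuity_pt_comp (fun t => t - s) sqrt).
      * apply continuity_pt_minus; [apply continuity_pt_id|apply continuity_pt_const; intros ? ?; reflexivity].
      * apply continuity_pt_sqrt. lra.
    + generalize (sqrt_pos (s - s)). lra.
Qed.

Lemma weight_int_infty (s : R) : filterlim (weight_int s) (Rbar_locally p_infty) (locally 0).
Proof.
  apply filterlim_0_eps; [apply Rbar_locally_filter|]. intros eps.
  exists (s + (/ eps) ^ 2). intros t ht. unfold weight_int. rewrite Rabs_Ropp.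
  assert (he := cond_pos eps). assert (0 < / eps) by (now apply Rinv_0_lt_compat).
  assert (h1 : / eps < sqrt (t - s)).
  { rewrite <- (sqrt_pow2 (/ eps)) by lra. apply sqrt_lt_1_alt. nra. }
  rewrite Rabs_right.
  - rewrite <- (Rinv_inv eps). apply Rinv_le_contravar; lra.
  - left. apply Rinv_0_lt_compat. lra.
Qed.

Lemma is_RInt_gen_weight (s : R) :
  is_RInt_gen (weight s) (at_right s) (Rbar_locally p_infty) 1.
Proof.
  replace 1 with (0 - (-1)) by ring. apply (is_RInt_gen_primitive _ _ (weight_int s)).
  - apply continuous_weight.
  - apply is_derive_weight_int.
  - apply weight_int_right.
  - apply weight_int_infty.
Qed.

Lemma nondecreasing_of_derive (f df : R -> R) (a b : R) :
  (forall t, a <= t <= b -> is_derive f t (df t)) -> (forall t, a <= t <= b -> 0 <= df t) ->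
  a <= b -> f a <= f b.
Proof.
  intros hd hp hab.
  destruct (MVT_gen f a b df) as [c [hc heq]].
  - intros t ht. apply hd. rewrite Rmin_left, Rmax_right in ht by lra. lra.
  - intros t ht. apply continuity_pt_filterlim.
    apply (ex_derive_continuous (K := R_AbsRing) (V := R_NormedModule)).
    exists (df t). apply hd. rewrite Rmin_left, Rmax_right in ht by lra. lra.
  - rewrite Rmin_left, Rmax_right in hc by lra. assert (0 <= df c) by (apply hp; lra). nra.
Qed.

(** Both [M * weight_int s - P] and [M * weight_int s + P] have a nonnegative derivative, so
    increments are compared without integrating [g]. The absolute value on the right makes the bound
    symmetric in [a] and [b], as the Cauchy criterion requires. *)
Lemma primitive_dominated (s M : R) (g P : R -> R) :
  (forall t, s < t -> is_derive P t (g t)) ->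
  (forall t, s < t -> Rabs (g t) <= M * weight s t) ->
  forall a b, s < a -> s < b -> Rabs (P b - P a) <= M * Rabs (weight_int s b - weight_int s a).
Proof.
  intros hP hM.
  assert (H : forall a b, s < a -> a <= b ->
    Rabs (P b - P a) <= M * (weight_int s b - weight_int s a)
    /\ 0 <= weight_int s b - weight_int s a).
  { intros a b ha hab.
    assert (h1 : M * weight_int s a - P a <= M * weight_int s b - P b).
    { apply (nondecreasing_of_derive (fun t => M * weight_int s t - P t)
        (fun t => M * weight s t - g t)); try assumption.
      - intros t [ht _]. assert (s < t) by lra. apply (is_derive_minus (K := R_AbsRing) (V := R_NormedModule)); [|now apply hP].
        apply is_derive_scal. now apply is_derive_weight_int.
      - intros t [ht _]. generalize (hM t ltac:(lra)) (Rle_abs (g t)). lra. }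
    assert (h2 : M * weight_int s a + P a <= M * weight_int s b + P b).
    { apply (nondecreasing_of_derive (fun t => M * weight_int s t + P t)
        (fun t => M * weight s t + g t)); try assumption.
      - intros t [ht _]. assert (s < t) by lra. apply (is_derive_plus (K := R_AbsRing) (V := R_NormedModule)); [|now apply hP].
        apply is_derive_scal. now apply is_derive_weight_int.
      - intros t [ht _]. generalize (hM t ltac:(lra)) (Rle_abs (- g t)). rewrite Rabs_Ropp. lra. }
    assert (h3 : weight_int s a <= weight_int s b).
    { apply (nondecreasing_of_derive _ (weight s)); try assumption.
      - intros t ht. apply is_derive_weight_int. lra.
      - intros t ht. left. apply weight_pos. lra. }
    split; [apply Rabs_le|]; lra. }
  intros a b ha hb. destruct (Rle_or_lt a b) as [h|h].
  - destruct (H a b ha h) as [h1 h2]. rewrite (Rabs_right (weight_int s b - _)); lra.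
  - destruct (H b a hb) as [h1 h2]; [lra|].
    rewrite Rabs_minus_sym, (Rabs_minus_sym (weight_int s b)).
    rewrite (Rabs_right (weight_int s a - _)); lra.
Qed.

(** [P] inherits the Cauchy property from [W]. The filter is left general so that one statement
    serves both ends of the half-line. *)
Lemma cauchy_dominated (F : (R -> Prop) -> Prop) {FF : ProperFilter F} (P W : R -> R) (s M w : R) :
  F (fun t => s < t) ->
  (forall a b, s < a -> s < b -> Rabs (P b - P a) <= M * Rabs (W b - W a)) ->
  filterlim W F (locally w) -> exists l : R, filterlim P F (locally l).
Proof.
  intros hs hP hW.
  apply (proj1 (filterlim_locally_cauchy (U := R_CompleteSpace) P)). intros eps.
  assert (hK : 0 < Rabs M + 1) by (generalize (Rabs_pos M); lra).
  (* The 2 pays for comparing two values of [W] through the limit [w]; the [+ 1] keeps the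
     denominator positive when [M] is 0. *)
  assert (he : 0 < eps / (2 * (Rabs M + 1))).
  { apply Rdiv_lt_0_compat; [apply cond_pos|lra]. }
  exists (fun t => s < t /\ ball w (mkposreal _ he) (W t)). split.
  - apply filter_and; [exact hs|]. apply (proj1 (filterlim_locally W w) hW).
  - intros u v [hu1 hu2] [hv1 hv2].
    unfold ball in *; simpl in *; unfold AbsRing_ball, abs, minus, plus, opp in *; simpl in *.
    change (P v + - P u) with (P v - P u). eapply Rle_lt_trans; [now apply hP|].
    apply Rle_lt_trans with (Rabs M * Rabs (W v - W u)).
    { apply Rmult_le_compat_r; [apply Rabs_pos|apply Rle_abs]. }
    assert (h : Rabs (W v - W u) <= 2 * (eps / (2 * (Rabs M + 1)))).
    { replace (W v - W u) with ((W v + - w) - (W u + - w)) by ring.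
      eapply Rle_trans; [apply Rabs_triang|]. rewrite Rabs_Ropp. lra. }
    apply Rle_lt_trans with (Rabs M * (2 * (eps / (2 * (Rabs M + 1))))).
    { apply Rmult_le_compat_l; [apply Rabs_pos|exact h]. }
    apply Rlt_le_trans with ((Rabs M + 1) * (2 * (eps / (2 * (Rabs M + 1))))).
    { apply Rmult_lt_compat_r; lra. }
    right. field. lra.
Qed.

Lemma continuous_primitive (s : R) (g : R -> R) :
  (forall t, s < t -> continuous g t) -> exists P, forall t, s < t -> is_derive P t (g t).
Proof.
  intros hg. exists (fun t => RInt g (s + 1) t). intros t ht.
  apply (is_derive_RInt g _ (s + 1)); [|now apply hg].
  assert (h' : 0 < t - s) by lra. exists (mkposreal _ h'). intros y hb.
  unfold ball in hb; simpl in hb; unfold AbsRing_ball, abs, minus, plus, opp in hb; simpl in hb.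
  apply Rabs_def2 in hb. apply (RInt_correct (V := R_CompleteNormedModule)).
  apply (ex_RInt_continuous (V := R_CompleteNormedModule)). intros z hz. apply hg.
  apply Rlt_le_trans with (2 := proj1 hz). apply Rmin_glb_lt; lra.
Qed.

Lemma ex_RInt_gen_dominated (s M : R) (g : R -> R) :
  (forall t, s < t -> continuous g t) ->
  (forall t, s < t -> Rabs (g t) <= M * weight s t) ->
  ex_RInt_gen g (at_right s) (Rbar_locally p_infty).
Proof.
  intros hg hM. destruct (continuous_primitive s g hg) as [P hP].
  assert (hd := primitive_dominated s M g P hP hM).
  destruct (cauchy_dominated (at_right s) P (weight_int s) s M (-1)) as [la ha];
    [apply at_right_gt|exact hd|apply weight_int_right|].
  destruct (cauchy_dominated (Rbar_locally p_infty) P (weight_int s) s M 0) as [lb hb];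
    [apply p_infty_gt|exact hd|apply weight_int_infty|].
  exists (lb - la). now apply (is_RInt_gen_primitive s g P).
Qed.

Definition half_int (s : R) (g : R -> R) : R :=
  RInt_gen (V := R_CompleteNormedModule) g (at_right s) (Rbar_locally p_infty).

Lemma half_int_unique (s : R) (g : R -> R) (l : R) :
  is_RInt_gen g (at_right s) (Rbar_locally p_infty) l -> half_int s g = l.
Proof. exact (is_RInt_gen_unique (V := R_CompleteNormedModule) g l). Qed.

Lemma half_int_dominated (s M : R) (g : R -> R) :
  (forall t, s < t -> continuous g t) ->
  (forall t, s < t -> Rabs (g t) <= M * weight s t) ->
  is_RInt_gen g (at_right s) (Rbar_locally p_infty) (half_int s g).
Proof.
  intros hg hM. apply (RInt_gen_correct (V := R_CompleteNormedModule)).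
  now apply (ex_RInt_gen_dominated s M).
Qed.

(** The weight has total mass 1, so the constant of the pointwise bound is itself the bound for the
    integral. *)
Lemma is_RInt_gen_half_le (s M : R) (g : R -> R) (l : R) :
  is_RInt_gen g (at_right s) (Rbar_locally p_infty) l ->
  (forall t, s < t -> Rabs (g t) <= M * weight s t) -> Rabs l <= M.
Proof.
  intros hl hM.
  apply (RInt_gen_norm (V := R_CompleteNormedModule) (Fa := at_right s) (Fb := Rbar_locally p_infty)
    g (fun t => M * weight s t) l M).
  (* Separating the endpoints at [s + 1] guarantees [a <= b], which the norm inequality for
     integrals requires. *)
  - apply (Filter_prod _ _ _ (fun t => s < t < s + 1) (fun t => s + 1 < t)).
    + apply at_right_lt. lra.
    + apply p_infty_gt.
    + intros a b; simpl; lra.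
  - apply (Filter_prod _ _ _ (fun t => s < t < s + 1) (fun t => s + 1 < t)).
    + apply at_right_lt. lra.
    + apply p_infty_gt.
    + intros a b h1 h2 t ht; simpl in ht. apply hM. lra.
  - exact hl.
  - replace M with (scal M 1) at 1 by (unfold scal; simpl; unfold mult; simpl; ring).
    apply (is_RInt_gen_scal (V := R_NormedModule) (weight s) M 1).
    apply is_RInt_gen_weight.
Qed.

(** * Differentiation under the integral sign, from quadratic remainders *)

Lemma is_derive_quadratic (G : R -> R) (x l K d : R) :
  0 < d ->
  (forall h, Rabs h < d -> Rabs (G (x + h) - G x - h * l) <= K * h ^ 2) -> is_derive G x l.
Proof.
  intros hd H. apply is_derive_Reals. intros eps he.
  assert (hK : 0 < Rabs K + 1) by (generalize (Rabs_pos K); lra).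
  assert (hm : 0 < Rmin d (eps / (Rabs K + 1))).
  { apply Rmin_glb_lt; [exact hd|]. apply Rdiv_lt_0_compat; lra. }
  exists (mkposreal _ hm). intros h h0 hh. simpl in hh.
  assert (h1 : Rabs h < d) by (eapply Rlt_le_trans; [exact hh|apply Rmin_l]).
  assert (h2 : Rabs h < eps / (Rabs K + 1)) by (eapply Rlt_le_trans; [exact hh|apply Rmin_r]).
  assert (h3 : 0 < Rabs h) by (now apply Rabs_pos_lt).
  replace ((G (x + h) - G x) / h - l) with ((G (x + h) - G x - h * l) / h) by (field; exact h0).
  unfold Rdiv. rewrite Rabs_mult, Rabs_inv.
  apply Rle_lt_trans with ((Rabs K + 1) * Rabs h).
  - apply Rmult_le_reg_r with (Rabs h); [exact h3|].
    rewrite Rmult_assoc, Rinv_l by lra. rewrite Rmult_1_r.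
    eapply Rle_trans; [now apply H|]. rewrite <- (pow2_abs h). generalize (Rle_abs K). nra.
  - apply Rlt_le_trans with ((Rabs K + 1) * (eps / (Rabs K + 1))).
    + now apply Rmult_lt_compat_l.
    + right. field. lra.
Qed.

Lemma is_derive_continuous (f : R -> R) (x l : R) : is_derive f x l -> continuous f x.
Proof.
  intros h. apply (ex_derive_continuous (K := R_AbsRing) (V := R_NormedModule)). now exists l.
Qed.

Lemma MVT_ball (f df : R -> R) (x d : R) :
  (forall z, Rabs (z - x) < d -> is_derive f z (df z)) ->
  forall h, Rabs h < d -> exists k, Rabs k <= Rabs h /\ f (x + h) - f x = df (x + k) * h.
Proof.
  intros hf h hh.
  assert (hb : forall t, Rmin x (x + h) <= t <= Rmax x (x + h) -> Rabs (t - x) <= Rabs h).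
  { intros t. unfold Rmin, Rmax, Rabs.
    destruct (Rle_dec x (x + h)), (Rcase_abs (t - x)), (Rcase_abs h); lra. }
  destruct (MVT_gen f x (x + h) df) as [c [hc heq]].
  - intros t ht. apply hf. apply Rle_lt_trans with (Rabs h); [apply hb; lra|exact hh].
  - intros t ht. apply continuity_pt_filterlim. apply (is_derive_continuous f t (df t)), hf.
    apply Rle_lt_trans with (Rabs h); [now apply hb|exact hh].
  - exists (c - x). split; [now apply hb|].
    replace (x + (c - x)) with c by ring. rewrite heq. ring.
Qed.

Lemma taylor_quadratic (f f1 f2 : R -> R) (x d B : R) :
  (forall z, Rabs (z - x) < d -> is_derive f z (f1 z)) ->
  (forall z, Rabs (z - x) < d -> is_derive f1 z (f2 z)) ->
  (forall z, Rabs (z - x) < d -> Rabs (f2 z) <= B) ->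
  forall h, Rabs h < d -> Rabs (f (x + h) - f x - h * f1 x) <= B * h ^ 2.
Proof.
  intros h1 h2 hB h hh.
  destruct (MVT_ball f f1 x d h1 h hh) as [k [hk e1]].
  destruct (MVT_ball f1 f2 x d h2 k) as [m [hm e2]]; [lra|].
  replace (f (x + h) - f x - h * f1 x) with (f2 (x + m) * k * h) by nra.
  rewrite !Rabs_mult, <- (pow2_abs h).
  assert (hf2 : Rabs (f2 (x + m)) <= B).
  { apply hB. replace (x + m - x) with m by ring. lra. }
  generalize (Rabs_pos (f2 (x + m))) (Rabs_pos k) (Rabs_pos h). intros p1 p2 p3.
  apply Rle_trans with (Rabs (f2 (x + m)) * Rabs h * Rabs h).
  - apply Rmult_le_compat_r; [exact p3|]. now apply Rmult_le_compat_l.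
  - nra.
Qed.

(* The second-order Taylor remainder, integrated against the weight, is O(h^2). *)
Lemma is_derive_half_int (s M x d : R) (F F1 F2 : R -> R -> R) :
  0 < d ->
  (forall z t, Rabs (z - x) < d -> s < t -> is_derive (fun u => F u t) z (F1 z t)) ->
  (forall z t, Rabs (z - x) < d -> s < t -> is_derive (fun u => F1 u t) z (F2 z t)) ->
  (forall z t, Rabs (z - x) < d -> s < t -> continuous (F z) t) ->
  (forall t, s < t -> continuous (F1 x) t) ->
  (forall z t, Rabs (z - x) < d -> s < t -> Rabs (F z t) <= M * weight s t) ->
  (forall t, s < t -> Rabs (F1 x t) <= M * weight s t) ->
  (forall z t, Rabs (z - x) < d -> s < t -> Rabs (F2 z t) <= M * weight s t) ->
  is_derive (fun z => half_int s (F z)) x (half_int s (F1 x)).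
Proof.
  intros hd hF hF1 cF cF1 bF bF1 bF2.
  apply (is_derive_quadratic _ _ _ M d hd). intros h hh.
  assert (hx : Rabs (x - x) < d) by (now rewrite Rminus_diag, Rabs_R0).
  assert (hxh : Rabs (x + h - x) < d) by (now replace (x + h - x) with h by ring).
  apply (is_RInt_gen_half_le s (M * h ^ 2) (fun t => F (x + h) t - F x t - h * F1 x t)).
  - apply (is_RInt_gen_minus (V := R_NormedModule)).
    + apply (is_RInt_gen_minus (V := R_NormedModule)); apply (half_int_dominated s M); auto.
    + apply (is_RInt_gen_scal (V := R_NormedModule)). apply (half_int_dominated s M); auto.
  - intros t ht. replace (M * h ^ 2 * weight s t) with (M * weight s t * h ^ 2) by ring.
    apply (taylor_quadratic (fun u => F u t) (fun u => F1 u t) (fun u => F2 u t) x d); auto.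
Qed.

(** * The Airy integrand on a shifted contour *)

Lemma exp_ge_1_plus (x : R) : 1 + x <= exp x.
Proof.
  destruct (Req_dec x 0) as [->|h]; [rewrite exp_0; lra|]. left. now apply exp_ineq1.
Qed.

Lemma exp_nondecreasing (x y : R) : x <= y -> exp x <= exp y.
Proof. intros [h| ->]; [left; now apply exp_increasing|lra]. Qed.

Lemma cube_le_exp (v : R) : 0 <= v -> (1 + v) ^ 3 <= exp (3 * v).
Proof.
  intros hv. replace (3 * v) with (v + v + v) by ring. rewrite !exp_plus.
  replace (exp v * exp v * exp v) with (exp v ^ 3) by ring.
  apply pow_incr. split; [lra|apply exp_ge_1_plus].
Qed.

(** [9 / 4] is the maximum of [3 * v - v ^ 2], reached at [v = 3 / 2], where [v] stands for
    [sqrt (t - s)]; the 2 cancels the one in [weight]. *)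
Definition weight_const : R := 2 * exp (9 / 4).

Lemma weight_const_pos : 0 < weight_const.
Proof. unfold weight_const. generalize (exp_pos (9 / 4)). lra. Qed.

(** With [v = sqrt (t - s)], one has [1 + / v = (1 + v) ^ 3 / (v * (1 + v) ^ 2)], so the claim
    amounts to [(1 + v) ^ 3 * exp (- v ^ 2) <= exp (9 / 4)]. It is what makes a function with an
    inverse square root singularity at [s] integrable against the kernel. *)
Lemma singular_exp_le_weight (s t : R) : s < t ->
  (1 + / sqrt (t - s)) * exp (- (t - s)) <= weight_const * weight s t.
Proof.
  intros h. unfold weight, weight_const.
  assert (h0 : 0 < sqrt (t - s)) by (apply sqrt_lt_R0; lra).
  replace (exp (- (t - s))) with (exp (- (sqrt (t - s)) ^ 2)).
  2:{ rewrite pow2_sqrt by lra. reflexivity. }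
  set (v := sqrt (t - s)) in *.
  assert (h1 : (1 + v) ^ 3 <= exp (3 * v)).
  { apply cube_le_exp; lra. }
  assert (h2 : (1 + v) ^ 3 * exp (- v ^ 2) <= exp (9 / 4)).
  { apply Rle_trans with (exp (3 * v) * exp (- v ^ 2)).
    - apply Rmult_le_compat_r; [left; apply exp_pos|exact h1].
    - rewrite <- exp_plus. apply exp_nondecreasing. generalize (pow2_ge_0 (v - 3 / 2)). nra. }
  replace ((1 + / v) * exp (- v ^ 2)) with ((1 + v) ^ 3 * exp (- v ^ 2) * / (v * (1 + v) ^ 2))
    by (field; lra).
  replace (2 * exp (9 / 4) * / (2 * v * (1 + v) ^ 2)) with (exp (9 / 4) * / (v * (1 + v) ^ 2))
    by (field; lra).
  apply Rmult_le_compat_r; [|exact h2]. left. apply Rinv_0_lt_compat. nra.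
Qed.

Lemma exp_le_weight (s t : R) : s < t -> exp (- (t - s)) <= weight_const * weight s t.
Proof.
  intros h. eapply Rle_trans; [|now apply singular_exp_le_weight].
  assert (h0 : 0 < / sqrt (t - s)) by (apply Rinv_0_lt_compat, sqrt_lt_R0; lra).
  generalize (exp_pos (- (t - s))). nra.
Qed.

Lemma exp_decay_infty (M s : R) :
  filterlim (fun t => M * exp (- (t - s))) (Rbar_locally p_infty) (locally 0).
Proof.
  apply filterlim_0_eps; [apply Rbar_locally_filter|]. intros eps.
  exists (s + Rabs M / eps). intros t ht.
  assert (he := cond_pos eps).
  rewrite Rabs_mult, (Rabs_right (exp _)) by (left; apply exp_pos).
  rewrite exp_Ropp.
  assert (h1 : Rabs M / eps < exp (t - s)) by (generalize (exp_ge_1_plus (t - s)); lra).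
  apply Rmult_le_reg_r with (exp (t - s)); [apply exp_pos|].
  rewrite Rmult_assoc, Rinv_l by (generalize (exp_pos (t - s)); lra).
  apply (Rmult_lt_compat_l eps) in h1; [|exact he].
  replace (eps * (Rabs M / eps)) with (Rabs M) in h1 by (field; lra). lra.
Qed.

(* [airy_re eta x t] and [airy_im eta x t] are the real and imaginary parts of
   exp (i (z^3/3 + x z)) at z = t + i eta. *)
Definition airy_re (eta x t : R) : R :=
  exp (eta ^ 3 / 3 - x * eta - eta * t ^ 2) * cos (t ^ 3 / 3 - t * eta ^ 2 + x * t).

Definition airy_im (eta x t : R) : R :=
  exp (eta ^ 3 / 3 - x * eta - eta * t ^ 2) * sin (t ^ 3 / 3 - t * eta ^ 2 + x * t).

(* The real parts of (i z)^j exp (i (z^3/3 + x z)). *)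
Definition airy_re1 (eta x t : R) : R := - eta * airy_re eta x t - t * airy_im eta x t.

Definition airy_re2 (eta x t : R) : R :=
  (eta ^ 2 - t ^ 2) * airy_re eta x t + 2 * eta * t * airy_im eta x t.

Definition airy_re3 (eta x t : R) : R :=
  (3 * eta * t ^ 2 - eta ^ 3) * airy_re eta x t + (t ^ 3 - 3 * eta ^ 2 * t) * airy_im eta x t.

Ltac fold_powers :=
  repeat match goal with
  | |- context [?a * (?a * (?a * 1))] => change (a * (a * (a * 1))) with (a ^ 3)
  | |- context [?a * (?a * 1)] => change (a * (a * 1)) with (a ^ 2)
  end; unfold Rminus, Rdiv.

Lemma airy_im_0 (eta x : R) : airy_im eta x 0 = 0.
Proof.
  unfold airy_im. replace (0 ^ 3 / 3 - 0 * eta ^ 2 + x * 0) with 0 by field.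
  rewrite sin_0. ring.
Qed.

(** Along the imaginary direction d/d eta is i d/dz, which multiplies the integrand by - (z^2 + x);
    since - z^2 = (i z)^2, the first part is [airy_re2]. The next lemma is the matching
    Cauchy-Riemann equation, from d/dt = d/dz. *)
Lemma is_derive_airy_re_eta (eta x t : R) :
  is_derive (fun e => airy_re e x t) eta (airy_re2 eta x t - x * airy_re eta x t).
Proof. unfold airy_re2, airy_re, airy_im. auto_derive; [easy|]. fold_powers. field. Qed.

Lemma is_derive_airy_im_t (eta x t : R) :
  is_derive (airy_im eta x) t (x * airy_re eta x t - airy_re2 eta x t).
Proof. unfold airy_re2, airy_re, airy_im. auto_derive; [easy|]. fold_powers. field. Qed.

Lemma is_derive_airy_re (eta x t : R) : is_derive (fun u => airy_re eta u t) x (airy_re1 eta x t).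
Proof. unfold airy_re1, airy_re, airy_im. auto_derive; [easy|]. fold_powers. ring. Qed.

Lemma is_derive_airy_re1 (eta x t : R) : is_derive (fun u => airy_re1 eta u t) x (airy_re2 eta x t).
Proof. unfold airy_re1, airy_re2, airy_re, airy_im. auto_derive; [easy|]. fold_powers. ring. Qed.

Lemma is_derive_airy_re2 (eta x t : R) : is_derive (fun u => airy_re2 eta u t) x (airy_re3 eta x t).
Proof. unfold airy_re3, airy_re2, airy_re, airy_im. auto_derive; [easy|]. fold_powers. ring. Qed.

Lemma continuous_airy_re (eta x t : R) : continuous (airy_re eta x) t.
Proof.
  apply (ex_derive_continuous (K := R_AbsRing) (V := R_NormedModule)).
  unfold airy_re. now auto_derive.
Qed.

Lemma continuous_airy_re1 (eta x t : R) : continuous (airy_re1 eta x) t.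
Proof.
  apply (ex_derive_continuous (K := R_AbsRing) (V := R_NormedModule)).
  unfold airy_re1, airy_re, airy_im. now auto_derive.
Qed.

Lemma continuous_airy_re2 (eta x t : R) : continuous (airy_re2 eta x) t.
Proof.
  apply (ex_derive_continuous (K := R_AbsRing) (V := R_NormedModule)).
  unfold airy_re2, airy_re, airy_im. now auto_derive.
Qed.

Lemma airy_re_im_le (eta x t : R) :
  Rabs (airy_re eta x t) <= exp (eta ^ 3 / 3 - x * eta - eta * t ^ 2) /\
  Rabs (airy_im eta x t) <= exp (eta ^ 3 / 3 - x * eta - eta * t ^ 2).
Proof.
  unfold airy_re, airy_im.
  rewrite !Rabs_mult, (Rabs_right (exp _)) by (left; apply exp_pos).
  assert (he := exp_pos (eta ^ 3 / 3 - x * eta - eta * t ^ 2)).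
  assert (h1 := COS_bound (t ^ 3 / 3 - t * eta ^ 2 + x * t)).
  assert (h2 := SIN_bound (t ^ 3 / 3 - t * eta ^ 2 + x * t)).
  split; rewrite <- Rmult_1_r; (apply Rmult_le_compat_l; [lra|apply Rabs_le; lra]).
Qed.

(** The cube of [1 + eta] absorbs the coefficients in [airy_re1], [airy_re2] and [airy_re3],
    polynomials of degree at most 3 in [eta] and [t]. The term [4 / eta] is the maximum over [t] of
    [4 * t - eta * t ^ 2]: three units of [t] come from [(1 + t) ^ 3 <= exp (3 * t)], and the fourth
    produces the factor [exp (- t)]. *)
Definition airy_const (eta : R) : R := (1 + eta) ^ 3 * exp (eta ^ 3 / 3 + 4 / eta).

Lemma airy_const_pos (eta : R) : 0 < eta -> 0 < airy_const eta.
Proof.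
  intros h. unfold airy_const. apply Rmult_lt_0_compat; [|apply exp_pos].
  apply pow_lt. lra.
Qed.

Lemma airy_combination_le (eta x t a b : R) : 0 < eta -> 0 < t ->
  Rabs a + Rabs b <= (1 + eta) ^ 3 * (1 + t) ^ 3 ->
  Rabs (a * airy_re eta x t + b * airy_im eta x t) <= airy_const eta * exp (- eta * x) * exp (- t).
Proof.
  intros he ht hab. destruct (airy_re_im_le eta x t) as [h1 h2].
  set (E := exp (eta ^ 3 / 3 - x * eta - eta * t ^ 2)) in *.
  assert (hE : 0 < E) by apply exp_pos.
  apply Rle_trans with ((Rabs a + Rabs b) * E).
  { eapply Rle_trans; [apply Rabs_triang|]. rewrite !Rabs_mult.
    generalize (Rabs_pos a) (Rabs_pos b). nra. }
  apply Rle_trans with ((1 + eta) ^ 3 * (1 + t) ^ 3 * E).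
  { apply Rmult_le_compat_r; lra. }
  assert (h3 : (1 + t) ^ 3 <= exp (3 * t)).
  { apply cube_le_exp; lra. }
  unfold airy_const. rewrite !Rmult_assoc. apply Rmult_le_compat_l; [apply pow_le; lra|].
  apply Rle_trans with (exp (3 * t) * E); [apply Rmult_le_compat_r; lra|].
  unfold E. rewrite <- !exp_plus. apply exp_nondecreasing.
  assert (h4 : 0 <= eta * (t - 2 / eta) ^ 2) by (apply Rmult_le_pos; [lra|apply pow2_ge_0]).
  replace (eta * (t - 2 / eta) ^ 2) with (eta * t ^ 2 - 4 * t + 4 / eta) in h4 by (field; lra).
  nra.
Qed.

Lemma airy_re_decay (eta x t : R) : 0 < eta -> 0 < t ->
  Rabs (airy_re eta x t) <= airy_const eta * exp (- eta * x) * exp (- t).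
Proof.
  intros he ht. replace (airy_re eta x t) with (1 * airy_re eta x t + 0 * airy_im eta x t) by ring.
  apply airy_combination_le; try assumption. rewrite Rabs_R0, Rabs_R1, Rplus_0_r.
  rewrite <- Rpow_mult_distr. apply pow_R1_Rle. nra.
Qed.

Lemma airy_im_decay (eta x t : R) : 0 < eta -> 0 < t ->
  Rabs (airy_im eta x t) <= airy_const eta * exp (- eta * x) * exp (- t).
Proof.
  intros he ht. replace (airy_im eta x t) with (0 * airy_re eta x t + 1 * airy_im eta x t) by ring.
  apply airy_combination_le; try assumption. rewrite Rabs_R0, Rabs_R1, Rplus_0_l.
  rewrite <- Rpow_mult_distr. apply pow_R1_Rle. nra.
Qed.

Lemma pow_plus_le_cube (eta t : R) (n : nat) : 0 < eta -> 0 < t -> (n <= 3)%nat ->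
  (eta + t) ^ n <= (1 + eta) ^ 3 * (1 + t) ^ 3.
Proof.
  intros he ht hn. rewrite <- Rpow_mult_distr.
  apply Rle_trans with (((1 + eta) * (1 + t)) ^ n).
  - apply pow_incr. nra.
  - apply Rle_pow; [nra|exact hn].
Qed.

Lemma airy_re1_decay (eta x t : R) : 0 < eta -> 0 < t ->
  Rabs (airy_re1 eta x t) <= airy_const eta * exp (- eta * x) * exp (- t).
Proof.
  intros he ht. unfold airy_re1.
  replace (- eta * airy_re eta x t - t * airy_im eta x t)
    with (- eta * airy_re eta x t + - t * airy_im eta x t) by ring.
  apply airy_combination_le; try assumption.
  rewrite !Rabs_Ropp, !Rabs_right by lra.
  replace (eta + t) with ((eta + t) ^ 1) by ring. apply pow_plus_le_cube; auto.
Qed.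

Lemma Rabs_minus_le (a b c : R) : 0 <= a -> 0 <= b -> a + b <= c -> Rabs (a - b) <= c.
Proof. intros. apply Rabs_le. lra. Qed.

Lemma airy_re2_decay (eta x t : R) : 0 < eta -> 0 < t ->
  Rabs (airy_re2 eta x t) <= airy_const eta * exp (- eta * x) * exp (- t).
Proof.
  intros he ht. unfold airy_re2. apply airy_combination_le; try assumption.
  eapply Rle_trans; [|apply (pow_plus_le_cube eta t 2); auto].
  apply Rle_trans with ((eta ^ 2 + t ^ 2) + 2 * eta * t); [|right; ring].
  apply Rplus_le_compat.
  - apply Rabs_minus_le; nra.
  - rewrite Rabs_right; nra.
Qed.

Lemma airy_re3_decay (eta x t : R) : 0 < eta -> 0 < t ->
  Rabs (airy_re3 eta x t) <= airy_const eta * exp (- eta * x) * exp (- t).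
Proof.
  intros he ht. unfold airy_re3. apply airy_combination_le; try assumption.
  eapply Rle_trans; [|apply (pow_plus_le_cube eta t 3); auto].
  assert (0 < eta ^ 2) by (apply pow_lt; lra). assert (0 < t ^ 2) by (apply pow_lt; lra).
  assert (0 < eta ^ 3) by (apply pow_lt; lra). assert (0 < t ^ 3) by (apply pow_lt; lra).
  apply Rle_trans with ((3 * eta * t ^ 2 + eta ^ 3) + (t ^ 3 + 3 * eta ^ 2 * t)); [|right; ring].
  apply Rplus_le_compat; apply Rabs_minus_le; nra.
Qed.

Lemma decay_le_weight (B K t : R) : 0 <= K -> 0 < t ->
  B <= K * exp (- t) -> B <= K * weight_const * weight 0 t.
Proof.
  intros hK ht hB. eapply Rle_trans; [exact hB|]. rewrite Rmult_assoc.
  apply Rmult_le_compat_l; [exact hK|]. rewrite <- (Rminus_0_r t) at 1. now apply exp_le_weight.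
Qed.

Lemma airy_bound_pos (eta x : R) : 0 < eta -> 0 < airy_const eta * exp (- eta * x).
Proof. intros h. apply Rmult_lt_0_compat; [now apply airy_const_pos|apply exp_pos]. Qed.

(** Differentiating at [x] requires a bound uniform over a ball of radius 1; as [exp (- eta * z)]
    decreases in [z], its value at [x - 1] serves. *)
Lemma airy_weight_bound (eta x z t B : R) : 0 < eta -> 0 < t -> Rabs (z - x) < 1 ->
  B <= airy_const eta * exp (- eta * z) * exp (- t) ->
  B <= airy_const eta * exp (- eta * (x - 1)) * weight_const * weight 0 t.
Proof.
  intros he ht hz hB. apply decay_le_weight; [left; now apply airy_bound_pos|exact ht|].
  eapply Rle_trans; [exact hB|]. apply Rmult_le_compat_r; [left; apply exp_pos|].
  apply Rmult_le_compat_l; [left; now apply airy_const_pos|].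
  apply exp_nondecreasing. apply Rabs_def2 in hz. nra.
Qed.

Lemma Rabs_diag_lt_1 (x : R) : Rabs (x - x) < 1.
Proof. rewrite Rminus_diag, Rabs_R0. lra. Qed.

Lemma is_derive_half_int_airy_re (eta x : R) : 0 < eta ->
  is_derive (fun z => half_int 0 (airy_re eta z)) x (half_int 0 (airy_re1 eta x)).
Proof.
  intros he.
  apply (is_derive_half_int 0 (airy_const eta * exp (- eta * (x - 1)) * weight_const) x 1
    (airy_re eta) (airy_re1 eta) (airy_re2 eta)); intros; try lra.
  - apply is_derive_airy_re.
  - apply is_derive_airy_re1.
  - apply continuous_airy_re.
  - apply continuous_airy_re1.
  - apply (airy_weight_bound eta x z); auto. now apply airy_re_decay.
  - apply (airy_weight_bound eta x x); auto; [apply Rabs_diag_lt_1|]. now apply airy_re1_decay.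
  - apply (airy_weight_bound eta x z); auto. now apply airy_re2_decay.
Qed.

(** The Taylor remainder is controlled by one further derivative, which is why [airy_re3] and its
    decay enter although only two derivatives of [Ai] are computed. *)
Lemma is_derive_half_int_airy_re1 (eta x : R) : 0 < eta ->
  is_derive (fun z => half_int 0 (airy_re1 eta z)) x (half_int 0 (airy_re2 eta x)).
Proof.
  intros he.
  apply (is_derive_half_int 0 (airy_const eta * exp (- eta * (x - 1)) * weight_const) x 1
    (airy_re1 eta) (airy_re2 eta) (airy_re3 eta)); intros; try lra.
  - apply is_derive_airy_re1.
  - apply is_derive_airy_re2.
  - apply continuous_airy_re1.
  - apply continuous_airy_re2.
  - apply (airy_weight_bound eta x z); auto. now apply airy_re1_decay.
  - apply (airy_weight_bound eta x x); auto; [apply Rabs_diag_lt_1|]. now apply airy_re2_decay.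
  - apply (airy_weight_bound eta x z); auto. now apply airy_re3_decay.
Qed.

Lemma is_RInt_gen_airy_re (eta x : R) : 0 < eta ->
  is_RInt_gen (airy_re eta x) (at_right 0) (Rbar_locally p_infty) (half_int 0 (airy_re eta x)).
Proof.
  intros he. apply (half_int_dominated 0 (airy_const eta * exp (- eta * x) * weight_const)).
  - intros; apply continuous_airy_re.
  - intros t ht. apply decay_le_weight; [left; now apply airy_bound_pos|exact ht|].
    now apply airy_re_decay.
Qed.

Lemma is_RInt_gen_airy_re2 (eta x : R) : 0 < eta ->
  is_RInt_gen (airy_re2 eta x) (at_right 0) (Rbar_locally p_infty) (half_int 0 (airy_re2 eta x)).
Proof.
  intros he. apply (half_int_dominated 0 (airy_const eta * exp (- eta * x) * weight_const)).
  - intros; apply continuous_airy_re2.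
  - intros t ht. apply decay_le_weight; [left; now apply airy_bound_pos|exact ht|].
    now apply airy_re2_decay.
Qed.

Lemma filterlim_at_right_continuous (f : R -> R) (s l : R) :
  continuous f s -> f s = l -> filterlim f (at_right s) (locally l).
Proof.
  intros h <-. revert h.
  apply (filterlim_filter_le_1 (F := locally s) (G := at_right s)).
  intros P [e H]. exists e. intros y hy _. now apply H.
Qed.

(* The integrand of [airy_re2 - x airy_re] is the total derivative of [- airy_im]. *)
Lemma half_int_airy_re2 (eta x : R) : 0 < eta ->
  half_int 0 (airy_re2 eta x) = x * half_int 0 (airy_re eta x).
Proof.
  intros he.
  assert (h1 : is_RInt_gen (fun t => x * airy_re eta x t - airy_re2 eta x t)
    (at_right 0) (Rbar_locally p_infty) (0 - 0)).
  { apply (is_RInt_gen_primitive 0 _ (airy_im eta x)).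
    - intros t _. apply (ex_derive_continuous (K := R_AbsRing) (V := R_NormedModule)).
      unfold airy_re2, airy_re, airy_im. now auto_derive.
    - intros; apply is_derive_airy_im_t.
    - apply filterlim_at_right_continuous.
      + apply (is_derive_continuous _ _ _ (is_derive_airy_im_t eta x 0)).
      + apply airy_im_0.
    - apply (filterlim_0_squeeze _ _
        (fun t => airy_const eta * exp (- eta * x) * exp (- (t - 0)))); [|apply exp_decay_infty].
      exists 0. intros t ht. rewrite Rminus_0_r. eapply Rle_trans; [now apply airy_im_decay|apply Rle_abs]. }
  assert (h2 : is_RInt_gen (fun t => x * airy_re eta x t - airy_re2 eta x t)
    (at_right 0) (Rbar_locally p_infty)
    (x * half_int 0 (airy_re eta x) - half_int 0 (airy_re2 eta x))).
  { apply (is_RInt_gen_minus (V := R_NormedModule)).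
    - apply (is_RInt_gen_scal (V := R_NormedModule)). now apply is_RInt_gen_airy_re.
    - now apply is_RInt_gen_airy_re2. }
  apply half_int_unique in h1. apply half_int_unique in h2.
  assert (h3 := eq_trans (eq_sym h1) h2). lra.
Qed.

(** * The Airy function *)

Lemma continuity_2d_pt_pow (f : R -> R -> R) (n : nat) (u v : R) :
  continuity_2d_pt f u v -> continuity_2d_pt (fun a b => f a b ^ n) u v.
Proof.
  intros hf. induction n as [|n IH]; simpl.
  - apply continuity_2d_pt_const.
  - now apply continuity_2d_pt_mult.
Qed.

Ltac continuity_2d_step := first
  [ apply continuity_2d_pt_id1 | apply continuity_2d_pt_id2 | apply continuity_2d_pt_const
  | apply continuity_2d_pt_plus | apply continuity_2d_pt_minus
  | apply continuity_2d_pt_opp | apply continuity_2d_pt_pow | apply continuity_2d_pt_mult ].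

Ltac continuity_2d := repeat continuity_2d_step.

Lemma continuity_2d_pt_airy_re (x u v : R) : continuity_2d_pt (fun a b => airy_re a x b) u v.
Proof.
  unfold airy_re, Rdiv. apply continuity_2d_pt_mult.
  - apply continuity_1d_2d_pt_comp; [apply derivable_continuous_pt, derivable_pt_exp|].
    continuity_2d.
  - apply continuity_1d_2d_pt_comp; [apply derivable_continuous_pt, derivable_pt_cos|].
    continuity_2d.
Qed.

Lemma continuity_2d_pt_airy_im (x u v : R) : continuity_2d_pt (fun a b => airy_im a x b) u v.
Proof.
  unfold airy_im, Rdiv. apply continuity_2d_pt_mult.
  - apply continuity_1d_2d_pt_comp; [apply derivable_continuous_pt, derivable_pt_exp|].
    continuity_2d.
  - apply continuity_1d_2d_pt_comp; [apply derivable_continuous_pt, derivable_pt_sin|].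
    continuity_2d.
Qed.

(* The derivative in eta of the integrand is the t-derivative of [- airy_im]
   (Cauchy-Riemann), so only the boundary term at t = T survives. *)
Lemma is_derive_RInt_airy_re (T x eta : R) :
  is_derive (fun e => RInt (airy_re e x) 0 T) eta (- airy_im eta x T).
Proof.
  replace (- airy_im eta x T) with (RInt (fun t => Derive (fun e => airy_re e x t) eta) 0 T).
  - apply (is_derive_RInt_param (fun e t => airy_re e x t) 0 T eta).
    + apply filter_forall. intros e t _. eexists. apply is_derive_airy_re_eta.
    + intros t _.
      apply (continuity_2d_pt_ext (fun u v => airy_re2 u x v - x * airy_re u x v)).
      * intros u v. symmetry. apply is_derive_unique, is_derive_airy_re_eta.
      * assert (h1 := continuity_2d_pt_airy_re x eta t).
        assert (h2 := continuity_2d_pt_airy_im x eta t).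
        unfold airy_re2. repeat first [exact h1 | exact h2 | progress continuity_2d_step].
    + apply filter_forall. intros e. apply (ex_RInt_continuous (V := R_CompleteNormedModule)).
      intros z _. apply continuous_airy_re.
  - apply (is_RInt_unique (V := R_CompleteNormedModule)).
    apply (is_RInt_ext (V := R_NormedModule) (fun t => - (x * airy_re eta x t - airy_re2 eta x t))).
    { intros t _. symmetry. apply is_derive_unique.
      replace (- (x * airy_re eta x t - airy_re2 eta x t))
        with (airy_re2 eta x t - x * airy_re eta x t) by ring.
      apply is_derive_airy_re_eta. }
    replace (- airy_im eta x T) with (opp (minus (airy_im eta x T) (airy_im eta x 0)))
      by (rewrite airy_im_0; unfold opp, minus, plus, opp; simpl; ring).
    apply (is_RInt_opp (V := R_NormedModule)).
    apply (is_RInt_derive (V := R_CompleteNormedModule)).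
    + intros; apply is_derive_airy_im_t.
    + intros t _. apply (ex_derive_continuous (K := R_AbsRing) (V := R_NormedModule)).
      unfold airy_re2, airy_re, airy_im. now auto_derive.
Qed.

(* The eta-derivative of the integral is bounded by [C exp (- eta T^2)], whose integral
   over eta >= 0 is [C / T^2]. *)
Lemma contour_shift_bound (T x eta : R) : 0 < T -> 0 < eta ->
  Rabs (RInt (airy_re eta x) 0 T - RInt (airy_re 0 x) 0 T)
    <= exp (eta ^ 3 / 3 + Rabs x * eta) / T ^ 2.
Proof.
  intros hT he. set (C := exp (eta ^ 3 / 3 + Rabs x * eta)).
  assert (hC : 0 < C) by apply exp_pos.
  assert (hT2 : 0 < T ^ 2) by (now apply pow_lt).
  assert (hb : forall e, 0 <= e <= eta -> Rabs (airy_im e x T) <= C * exp (- e * T ^ 2)).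
  { intros e hee. eapply Rle_trans; [apply airy_re_im_le|]. unfold C. rewrite <- exp_plus.
    apply exp_nondecreasing.
    assert (e ^ 3 <= eta ^ 3) by (apply pow_incr; lra).
    assert (- x * e <= Rabs x * eta).
    { apply Rle_trans with (Rabs x * e).
      - apply Rmult_le_compat_r; [lra|]. rewrite <- Rabs_Ropp. apply Rle_abs.
      - apply Rmult_le_compat_l; [apply Rabs_pos|lra]. }
    lra. }
  (* The subtracted term is minus a primitive of the bound [C * exp (- e * T ^ 2)], so the whole
     expression is nondecreasing in [e] on [[0, eta]]. Taking [sg] as 1 and as -1 gives the two
     halves of the absolute value, and the comparison reaches [e = 0], where the integrand no longer
     decays. *)
  assert (hd : forall (sg e : R), is_derive
    (fun e => sg * RInt (airy_re e x) 0 T - C / T ^ 2 * exp (- e * T ^ 2)) e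
    (sg * - airy_im e x T - - (C * exp (- e * T ^ 2)))).
  { intros sg e. apply (is_derive_minus (K := R_AbsRing) (V := R_NormedModule)).
    - apply is_derive_scal, is_derive_RInt_airy_re.
    - auto_derive; [easy|]. fold_powers. field. lra. }
  assert (hm : forall sg, Rabs sg = 1 ->
    sg * (RInt (airy_re eta x) 0 T - RInt (airy_re 0 x) 0 T) + C / T ^ 2 * (1 - exp (- eta * T ^ 2)) >= 0).
  { intros sg hsg.
    destruct (MVT_gen (fun e => sg * RInt (airy_re e x) 0 T - C / T ^ 2 * exp (- e * T ^ 2)) 0 eta
      (fun e => sg * - airy_im e x T - - (C * exp (- e * T ^ 2)))) as [c [hc eq]].
    - intros; apply hd.
    - intros e _. apply continuity_pt_filterlim. exact (is_derive_continuous _ _ _ (hd sg e)).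
    - rewrite Rmin_left, Rmax_right in hc by lra.
      assert (h1 : - (sg * airy_im c x T) >= - (C * exp (- c * T ^ 2))).
      { apply Ropp_ge_contravar, Rle_ge. eapply Rle_trans; [apply Rle_abs|].
        rewrite Rabs_mult, hsg, Rmult_1_l. now apply hb. }
      replace (- 0 * T ^ 2) with 0 in eq by ring. rewrite exp_0 in eq.
      assert (0 <= (sg * - airy_im c x T - - (C * exp (- c * T ^ 2))) * (eta - 0)).
      { apply Rmult_le_pos; lra. }
      lra. }
  assert (hq : 0 < C / T ^ 2) by (now apply Rdiv_lt_0_compat).
  assert (hexp := exp_pos (- eta * T ^ 2)).
  assert (hfin : C / T ^ 2 * (1 - exp (- eta * T ^ 2)) <= C / T ^ 2) by nra.
  assert (hp := hm 1 Rabs_R1).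
  assert (hn := hm (-1)). rewrite Rabs_left in hn by lra. specialize (hn ltac:(lra)).
  apply Rabs_le. lra.
Qed.

(** This reconciles [half_int], a limit at both ends, with integrals whose left end is exactly 0;
    the integrand is continuous there. *)
Lemma RInt_airy_re_infty (eta x : R) : 0 < eta ->
  filterlim (fun T => RInt (airy_re eta x) 0 T) (Rbar_locally p_infty)
    (locally (half_int 0 (airy_re eta x))).
Proof.
  intros he.
  assert (hd : forall t, is_derive (fun T => RInt (airy_re eta x) 0 T) t (airy_re eta x t)).
  { intros t. apply (is_derive_RInt (airy_re eta x) _ 0 t); [|apply continuous_airy_re].
    apply filter_forall. intros y. apply (RInt_correct (V := R_CompleteNormedModule)).
    apply (ex_RInt_continuous (V := R_CompleteNormedModule)).
    intros; apply continuous_airy_re. }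
  destruct (cauchy_dominated (Rbar_locally p_infty) (fun T => RInt (airy_re eta x) 0 T)
    (weight_int 0) 0 (airy_const eta * exp (- eta * x) * weight_const) 0) as [l hl].
  - apply p_infty_gt.
  - apply primitive_dominated with (airy_re eta x).
    + intros; apply hd.
    + intros t ht. apply decay_le_weight; [left; now apply airy_bound_pos|exact ht|].
      now apply airy_re_decay.
  - apply weight_int_infty.
  - replace (half_int 0 (airy_re eta x)) with l; [exact hl|].
    symmetry. apply half_int_unique.
    replace l with (l - 0) by ring.
    apply (is_RInt_gen_primitive 0 _ (fun T => RInt (airy_re eta x) 0 T)); auto.
    + intros; apply continuous_airy_re.
    + apply (filterlim_at_right_continuous (fun T => RInt (airy_re eta x) 0 T)).
      * apply (is_derive_continuous _ _ _ (hd 0)).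
      * apply (RInt_point (V := R_CompleteNormedModule)).
Qed.

(** For fixed [eta] the contour shift costs O(1 / T^2), so the conditionally convergent integral on
    the real line has the limit of the absolutely convergent one at height [eta]. *)
Lemma RInt_airy_re_0_infty (eta x : R) : 0 < eta ->
  filterlim (fun T => RInt (airy_re 0 x) 0 T) (Rbar_locally p_infty)
    (locally (half_int 0 (airy_re eta x))).
Proof.
  intros he.
  apply (filterlim_ext (fun T => RInt (airy_re eta x) 0 T
    + (RInt (airy_re 0 x) 0 T - RInt (airy_re eta x) 0 T))); [intros; simpl; ring|].
  replace (half_int 0 (airy_re eta x)) with (half_int 0 (airy_re eta x) + 0) by ring.
  apply (filterlim_comp_2 (G := locally (half_int 0 (airy_re eta x))) (H := locally 0)
    (fun T => RInt (airy_re eta x) 0 T)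
    (fun T => RInt (airy_re 0 x) 0 T - RInt (airy_re eta x) 0 T) Rplus).
  - now apply RInt_airy_re_infty.
  - apply filterlim_0_eps; [apply Rbar_locally_filter|]. intros eps.
    set (C := exp (eta ^ 3 / 3 + Rabs x * eta)).
    assert (hC : 0 < C) by apply exp_pos. assert (hp := cond_pos eps).
    assert (hq : 0 < C / eps) by (now apply Rdiv_lt_0_compat).
    (* The summand 1 gives [T <= T ^ 2], whence [C / eps <= T ^ 2]. *)
    exists (1 + C / eps). intros T hT. rewrite Rabs_minus_sym.
    eapply Rle_trans; [apply contour_shift_bound; lra|]. fold C.
    apply Rmult_le_reg_r with (T ^ 2); [apply pow_lt; lra|].
    unfold Rdiv at 1. rewrite Rmult_assoc, Rinv_l, Rmult_1_r by (apply pow_nonzero; lra).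
    replace C with (eps * (C / eps)) by (field; lra).
    apply Rmult_le_compat_l; [lra|]. nra.
  - apply (filterlim_plus (V := R_NormedModule)).
Qed.

(** At height 0 the exponential factor is 1 and [airy_re 0 x] is the defining cosine. The freedom in
    [eta] is what yields decay at every exponential rate. *)
Lemma Ai_contour (eta x : R) : 0 < eta -> Ai x = / PI * half_int 0 (airy_re eta x).
Proof.
  intros he. unfold Ai. f_equal.
  apply (is_RInt_gen_unique (V := R_CompleteNormedModule)).
  apply (filterlimi_lim_ext_loc (fun ab : R * R => RInt (airy_re 0 x) 0 (snd ab))).
  - apply (Filter_prod _ _ _ (fun t => t = 0) (fun t => 0 < t)).
    + reflexivity.
    + apply p_infty_gt.
    + intros a b -> _; simpl.
      apply (is_RInt_ext (V := R_NormedModule) (airy_re 0 x)).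
      * intros t _. unfold airy_re.
        replace (0 ^ 3 / 3 - x * 0 - 0 * t ^ 2) with 0 by field. rewrite exp_0, Rmult_1_l.
        f_equal. field.
      * apply (RInt_correct (V := R_CompleteNormedModule)).
        apply (ex_RInt_continuous (V := R_CompleteNormedModule)).
        intros; apply continuous_airy_re.
  - apply (filterlim_comp _ _ _ snd (fun T => RInt (airy_re 0 x) 0 T) _ _ _ filterlim_snd).
    now apply RInt_airy_re_0_infty.
Qed.

Lemma is_derive_Ai_contour (eta x : R) : 0 < eta ->
  is_derive Ai x (/ PI * half_int 0 (airy_re1 eta x)).
Proof.
  intros he. apply (is_derive_ext (fun z => / PI * half_int 0 (airy_re eta z))).
  - intros z. symmetry. now apply Ai_contour.
  - apply is_derive_scal. now apply is_derive_half_int_airy_re.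
Qed.

Lemma is_derive_Ai (x : R) : is_derive Ai x (Derive Ai x).
Proof. apply Derive_correct. eexists. apply (is_derive_Ai_contour 1). lra. Qed.

Lemma Derive_Ai_contour (eta x : R) : 0 < eta ->
  Derive Ai x = / PI * half_int 0 (airy_re1 eta x).
Proof. intros he. now apply is_derive_unique, is_derive_Ai_contour. Qed.

Lemma airy_equation (x : R) : is_derive (Derive Ai) x (x * Ai x).
Proof.
  apply (is_derive_ext (fun z => / PI * half_int 0 (airy_re1 1 z))).
  - intros z. symmetry. apply Derive_Ai_contour. lra.
  - replace (x * Ai x) with (/ PI * half_int 0 (airy_re2 1 x)).
    + apply is_derive_scal. apply is_derive_half_int_airy_re1. lra.
    + rewrite half_int_airy_re2, (Ai_contour 1) by lra. ring.
Qed.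

(** All rates are required at once because the kernel must beat the growth of f, whose rate is
    arbitrary. Restricting to a half-line keeps the class stable under multiplication by [x]. *)
Definition fast_decay (s : R) (a : R -> R) : Prop :=
  forall eta, 0 < eta -> exists C, 0 < C /\ forall x, s < x -> Rabs (a x) <= C * exp (- eta * x).

Lemma half_int_decay (eta x : R) (g : R -> R) : 0 < eta -> (forall t, continuous g t) ->
  (forall t, 0 < t -> Rabs (g t) <= airy_const eta * exp (- eta * x) * exp (- t)) ->
  Rabs (/ PI * half_int 0 g) <= / PI * airy_const eta * weight_const * exp (- eta * x).
Proof.
  intros he hc hg. assert (hpi : 0 < / PI) by (apply Rinv_0_lt_compat, PI_RGT_0).
  rewrite Rabs_mult, (Rabs_right (/ PI)) by lra. rewrite !Rmult_assoc.
  apply Rmult_le_compat_l; [lra|].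
  assert (hw : forall t, 0 < t ->
    Rabs (g t) <= airy_const eta * exp (- eta * x) * weight_const * weight 0 t).
  { intros t ht. apply decay_le_weight; [left; now apply airy_bound_pos|exact ht|]. now apply hg. }
  rewrite (Rmult_comm weight_const), <- Rmult_assoc.
  apply (is_RInt_gen_half_le 0 _ g); [|exact hw].
  eapply half_int_dominated; [intros; apply hc|exact hw].
Qed.

Lemma Ai_fast_decay (s : R) : fast_decay s Ai.
Proof.
  intros eta he. exists (/ PI * airy_const eta * weight_const). split.
  - apply Rmult_lt_0_compat; [|apply weight_const_pos].
    apply Rmult_lt_0_compat; [apply Rinv_0_lt_compat, PI_RGT_0|now apply airy_const_pos].
  - intros x _. rewrite (Ai_contour eta) by exact he. apply half_int_decay; [exact he| |].
    + intros; apply continuous_airy_re.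
    + intros; now apply airy_re_decay.
Qed.

Lemma Derive_Ai_fast_decay (s : R) : fast_decay s (Derive Ai).
Proof.
  intros eta he. exists (/ PI * airy_const eta * weight_const). split.
  - apply Rmult_lt_0_compat; [|apply weight_const_pos].
    apply Rmult_lt_0_compat; [apply Rinv_0_lt_compat, PI_RGT_0|now apply airy_const_pos].
  - intros x _. rewrite (Derive_Ai_contour eta) by exact he. apply half_int_decay; [exact he| |].
    + intros; apply continuous_airy_re1.
    + intros; now apply airy_re1_decay.
Qed.

Lemma fast_decay_plus (s : R) (a b : R -> R) :
  fast_decay s a -> fast_decay s b -> fast_decay s (fun x => a x + b x).
Proof.
  intros ha hb eta he. destruct (ha eta he) as [A [hA hA']]. destruct (hb eta he) as [B [hB hB']].
  exists (A + B). split; [lra|]. intros x hx. rewrite Rmult_plus_distr_r.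
  eapply Rle_trans; [apply Rabs_triang|]. apply Rplus_le_compat; auto.
Qed.

(** One unit of the rate is spent on the factor: [Rabs x * exp (- x) <= exp (Rabs x - x)], and
    [Rabs x - x] is at most [2 * Rabs s] to the right of [s]. *)
Lemma fast_decay_mul_id (s : R) (a : R -> R) :
  fast_decay s a -> fast_decay s (fun x => x * a x).
Proof.
  intros ha eta he. destruct (ha (eta + 1)) as [A [hA hA']]; [lra|].
  exists (exp (2 * Rabs s) * A). split; [apply Rmult_lt_0_compat; [apply exp_pos|exact hA]|].
  intros x hx. rewrite Rabs_mult.
  apply Rle_trans with (Rabs x * (A * exp (- (eta + 1) * x))).
  { apply Rmult_le_compat_l; [apply Rabs_pos|]. now apply hA'. }
  replace (- (eta + 1) * x) with (- eta * x + - x) by ring. rewrite exp_plus.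
  assert (h : Rabs x * exp (- x) <= exp (2 * Rabs s)).
  { apply Rle_trans with (exp (Rabs x + - x)).
    - rewrite exp_plus. apply Rmult_le_compat_r; [left; apply exp_pos|].
      generalize (exp_ge_1_plus (Rabs x)). lra.
    - apply exp_nondecreasing. unfold Rabs. destruct (Rcase_abs x), (Rcase_abs s); lra. }
  assert (hp := Rmult_lt_0_compat _ _ hA (exp_pos (- eta * x))). nra.
Qed.

(** * The kernel *)

Definition decaying (s : R) (a : R -> R) : Prop :=
  fast_decay s a /\ forall x, s < x -> continuous a x.

Definition derives (s : R) (a a1 : R -> R) : Prop := forall x, s < x -> is_derive a x (a1 x).

(** For [a = b = Ai] this is the kernel k. The two slots are separate because d/dx differentiates
    only [a] and d/dy only [b], so every partial derivative of k has the same form. *)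
Definition shift_conv (a b : R -> R) (x y : R) : R := half_int 0 (fun t => a (x + t) * b (y + t)).

Lemma is_derive_shift (a : R -> R) (x t l : R) :
  is_derive a (x + t) l -> is_derive (fun u => a (u + t)) x l /\ is_derive (fun u => a (x + u)) t l.
Proof.
  intros h. split.
  - replace l with (scal 1 l) by (unfold scal; simpl; unfold mult; simpl; ring).
    apply (is_derive_comp (V := R_NormedModule) a (fun u => u + t)); [exact h|].
    now auto_derive; [|ring].
  - replace l with (scal 1 l) by (unfold scal; simpl; unfold mult; simpl; ring).
    apply (is_derive_comp (V := R_NormedModule) a (fun u => x + u)); [exact h|].
    now auto_derive; [|ring].
Qed.

Lemma continuous_shift (a : R -> R) (x t : R) :
  continuous a (x + t) -> continuous (fun u => a (x + u)) t.
Proof.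
  intros h. apply (continuous_comp (fun u => x + u) a); [|exact h].
  apply (continuous_plus (V := R_NormedModule)); [apply continuous_const|apply continuous_id].
Qed.

Lemma Rmult_continuous (f g : R -> R) (x : R) :
  continuous f x -> continuous g x -> continuous (fun t => f t * g t) x.
Proof. apply (continuous_mult (K := R_AbsRing)). Qed.

Lemma continuous_shift_prod (s x y : R) (a b : R -> R) : decaying s a -> decaying s b ->
  s < x -> s < y -> forall t, 0 < t -> continuous (fun t => a (x + t) * b (y + t)) t.
Proof.
  intros [_ ha] [_ hb] hx hy t ht.
  apply Rmult_continuous; apply continuous_shift; [apply ha|apply hb]; lra.
Qed.

Lemma shift_prod_decay (s : R) (a b : R -> R) (eta : R) : decaying s a -> decaying s b -> 1 <= eta ->
  exists C, 0 < C /\ forall x y t, s < x -> s < y -> 0 < t ->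
    Rabs (a (x + t) * b (y + t)) <= C * exp (- eta * (y - s)) * exp (- (2 * t)).
Proof.
  intros [ha _] [hb _] he.
  destruct (ha 1) as [A [hA hA']]; [lra|]. destruct (hb eta) as [B [hB hB']]; [lra|].
  exists (A * B * exp (- (1 + eta) * s)). split.
  { apply Rmult_lt_0_compat; [now apply Rmult_lt_0_compat|apply exp_pos]. }
  intros x y t hx hy ht. rewrite Rabs_mult.
  apply Rle_trans with ((A * exp (- 1 * (x + t))) * (B * exp (- eta * (y + t)))).
  { apply Rmult_le_compat; try apply Rabs_pos; [apply hA'|apply hB']; lra. }
  replace (A * exp (- 1 * (x + t)) * (B * exp (- eta * (y + t))))
    with (A * B * (exp (- 1 * (x + t)) * exp (- eta * (y + t)))) by ring.
  rewrite !Rmult_assoc. do 2 (apply Rmult_le_compat_l; [lra|]).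
  rewrite <- !exp_plus. apply exp_nondecreasing. nra.
Qed.

Lemma shift_prod_weight (s : R) (a b : R -> R) (eta : R) : decaying s a -> decaying s b -> 1 <= eta ->
  exists C, 0 < C /\ forall x y t, s < x -> s < y -> 0 < t ->
    Rabs (a (x + t) * b (y + t)) <= C * exp (- eta * (y - s)) * weight 0 t.
Proof.
  intros ha hb he. destruct (shift_prod_decay s a b eta ha hb he) as [C [hC H]].
  exists (C * weight_const).
  split; [apply Rmult_lt_0_compat; [exact hC|apply weight_const_pos]|].
  intros x y t hx hy ht.
  replace (C * weight_const * exp (- eta * (y - s)) * weight 0 t)
    with (C * exp (- eta * (y - s)) * weight_const * weight 0 t) by ring.
  apply decay_le_weight; [|exact ht|].
  - apply Rmult_le_pos; [lra|left; apply exp_pos].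
  - eapply Rle_trans; [now apply H|]. apply Rmult_le_compat_l.
    + apply Rmult_le_pos; [lra|left; apply exp_pos].
    + apply exp_nondecreasing. lra.
Qed.

Lemma is_RInt_gen_shift_conv (s x y : R) (a b : R -> R) : decaying s a -> decaying s b ->
  s < x -> s < y ->
  is_RInt_gen (fun t => a (x + t) * b (y + t)) (at_right 0) (Rbar_locally p_infty) (shift_conv a b x y).
Proof.
  intros ha hb hx hy. destruct (shift_prod_weight s a b 1 ha hb (Rle_refl 1)) as [C [_ H]].
  apply (half_int_dominated 0 (C * exp (- 1 * (y - s)))).
  - now apply (continuous_shift_prod s x y a b).
  - intros t ht. now apply H.
Qed.

Lemma shift_conv_decay (s : R) (a b : R -> R) (eta : R) : decaying s a -> decaying s b -> 1 <= eta ->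
  exists C, 0 < C /\ forall x y, s < x -> s < y ->
    Rabs (shift_conv a b x y) <= C * exp (- eta * (y - s)).
Proof.
  intros ha hb he. destruct (shift_prod_weight s a b eta ha hb he) as [C [hC H]].
  exists C. split; [exact hC|]. intros x y hx hy.
  apply (is_RInt_gen_half_le 0 _ (fun t => a (x + t) * b (y + t))).
  - now apply (is_RInt_gen_shift_conv s).
  - intros t ht. now apply H.
Qed.

Lemma shift_prod_bounded (s : R) (a b : R -> R) : decaying s a -> decaying s b ->
  exists C, 0 < C /\ forall x y t, s < x -> s < y -> 0 < t ->
    Rabs (a (x + t) * b (y + t)) <= C * weight 0 t.
Proof.
  intros ha hb. destruct (shift_prod_weight s a b 1 ha hb (Rle_refl 1)) as [C [hC H]].
  exists C. split; [exact hC|]. intros x y t hx hy ht. eapply Rle_trans; [now apply H|].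
  rewrite <- (Rmult_1_r C) at 2. apply Rmult_le_compat_r; [left; now apply weight_pos|].
  apply Rmult_le_compat_l; [lra|]. apply Rle_trans with (exp 0); [apply exp_nondecreasing; lra|rewrite exp_0; lra].
Qed.

Lemma Rabs_lt_ball (s x z : R) : Rabs (z - x) < x - s -> s < z.
Proof. intros h. apply Rabs_def2 in h. lra. Qed.

Lemma is_derive_mult_l (f : R -> R) (x l k : R) :
  is_derive f x l -> is_derive (fun t => f t * k) x (l * k).
Proof.
  intros h. apply (is_derive_ext (fun t => k * f t)); [intros; apply Rmult_comm|].
  rewrite (Rmult_comm l). now apply is_derive_scal.
Qed.

Lemma is_derive_shift_conv_l (s : R) (a a1 a2 b : R -> R) (x y : R) :
  decaying s a -> decaying s a1 -> decaying s a2 -> decaying s b ->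
  derives s a a1 -> derives s a1 a2 -> s < x -> s < y ->
  is_derive (fun z => shift_conv a b z y) x (shift_conv a1 b x y).
Proof.
  intros ha ha1 ha2 hb d1 d2 hx hy.
  destruct (shift_prod_bounded s a b ha hb) as [C0 [p0 B0]].
  destruct (shift_prod_bounded s a1 b ha1 hb) as [C1 [p1 B1]].
  destruct (shift_prod_bounded s a2 b ha2 hb) as [C2 [p2 B2]].
  (* A single constant has to dominate the function and both derivatives, hence the sum; the radius
     [x - s] keeps [z] to the right of [s]. *)
  apply (is_derive_half_int 0 (C0 + C1 + C2) x (x - s)
    (fun z t => a (z + t) * b (y + t)) (fun z t => a1 (z + t) * b (y + t))
    (fun z t => a2 (z + t) * b (y + t))); try lra.
  - intros z t hz ht. apply Rabs_lt_ball in hz.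
    apply is_derive_mult_l, (proj1 (is_derive_shift a z t _ (d1 (z + t) ltac:(lra)))).
  - intros z t hz ht. apply Rabs_lt_ball in hz.
    apply is_derive_mult_l, (proj1 (is_derive_shift a1 z t _ (d2 (z + t) ltac:(lra)))).
  - intros z t hz ht. apply Rabs_lt_ball in hz. now apply (continuous_shift_prod s z y a b).
  - now apply (continuous_shift_prod s x y a1 b).
  - intros z t hz ht. apply Rabs_lt_ball in hz.
    generalize (B0 z y t hz hy ht) (weight_pos 0 t ht). nra.
  - intros t ht. generalize (B1 x y t hx hy ht) (weight_pos 0 t ht). nra.
  - intros z t hz ht. apply Rabs_lt_ball in hz.
    generalize (B2 z y t hz hy ht) (weight_pos 0 t ht). nra.
Qed.

(** Exchanging the slots lets derivatives in the second variable be read off from those in the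
    first. *)
Lemma shift_conv_sym (s : R) (a b : R -> R) (x y : R) : decaying s a -> decaying s b ->
  s < x -> s < y -> shift_conv a b x y = shift_conv b a y x.
Proof.
  intros ha hb hx hy. apply half_int_unique.
  apply (is_RInt_gen_ext (V := R_NormedModule) (fun t => b (y + t) * a (x + t))).
  - apply filter_forall. intros; apply Rmult_comm.
  - now apply (is_RInt_gen_shift_conv s).
Qed.

Lemma is_derive_shift_conv_r (s : R) (a b b1 b2 : R -> R) (x y : R) :
  decaying s a -> decaying s b -> decaying s b1 -> decaying s b2 ->
  derives s b b1 -> derives s b1 b2 -> s < x -> s < y ->
  is_derive (shift_conv a b x) y (shift_conv a b1 x y).
Proof.
  intros ha hb hb1 hb2 d1 d2 hx hy.
  rewrite (shift_conv_sym s) by assumption.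
  apply (is_derive_ext_loc (fun z => shift_conv b a z x)).
  - assert (h : 0 < y - s) by lra. exists (mkposreal _ h). intros z hz.
    apply Rabs_lt_ball in hz. now apply (shift_conv_sym s).
  - now apply (is_derive_shift_conv_l s b b1 b2).
Qed.

(** From [Ai2] on, the Airy equation expresses each derivative through [Ai] and [Ai1], so its decay
    is inherited. Order four is reached because (K f)'' costs two further derivatives: one for the
    Taylor remainder in the integral over y, one for that in the integral over t. *)
Definition Ai1 : R -> R := Derive Ai.
Definition Ai2 (x : R) : R := x * Ai x.
Definition Ai3 (x : R) : R := Ai x + x * Ai1 x.
Definition Ai4 (x : R) : R := (Ai1 x + Ai1 x) + x * Ai2 x.

Lemma is_derive_mul_id (a : R -> R) (x l : R) :
  is_derive a x l -> is_derive (fun t => t * a t) x (a x + x * l).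
Proof.
  intros h. replace (a x + x * l) with (1 * a x + x * l) by ring.
  apply (is_derive_mult (fun t => t) a x 1 l); [apply (is_derive_id (K := R_AbsRing))|exact h|apply Rmult_comm].
Qed.

Lemma derives_Ai (s : R) : derives s Ai Ai1.
Proof. intros x _. apply is_derive_Ai. Qed.

Lemma derives_Ai1 (s : R) : derives s Ai1 Ai2.
Proof. intros x _. apply airy_equation. Qed.

Lemma derives_Ai2 (s : R) : derives s Ai2 Ai3.
Proof. intros x _. apply is_derive_mul_id, is_derive_Ai. Qed.

Lemma derives_Ai3 (s : R) : derives s Ai3 Ai4.
Proof.
  intros x _. unfold Ai4. rewrite Rplus_assoc.
  apply (is_derive_plus (K := R_AbsRing) (V := R_NormedModule)); [apply is_derive_Ai|].
  apply is_derive_mul_id, airy_equation.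
Qed.

Lemma decaying_derives (s : R) (a a1 : R -> R) : fast_decay s a -> derives s a a1 -> decaying s a.
Proof. intros h d. split; [exact h|]. intros x hx. exact (is_derive_continuous _ _ _ (d x hx)). Qed.

Lemma decaying_Ai (s : R) : decaying s Ai.
Proof. eapply decaying_derives; [apply Ai_fast_decay|apply derives_Ai]. Qed.

Lemma decaying_Ai1 (s : R) : decaying s Ai1.
Proof. eapply decaying_derives; [apply Derive_Ai_fast_decay|apply derives_Ai1]. Qed.

Lemma decaying_Ai2 (s : R) : decaying s Ai2.
Proof.
  eapply decaying_derives; [|apply derives_Ai2]. apply fast_decay_mul_id, Ai_fast_decay.
Qed.

Lemma decaying_Ai3 (s : R) : decaying s Ai3.
Proof.
  eapply decaying_derives; [|apply derives_Ai3].
  apply fast_decay_plus; [apply Ai_fast_decay|apply fast_decay_mul_id, Derive_Ai_fast_decay].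
Qed.

Lemma decaying_Ai4 (s : R) : decaying s Ai4.
Proof.
  split.
  - apply fast_decay_plus; [apply fast_decay_plus; apply Derive_Ai_fast_decay|].
    apply fast_decay_mul_id, fast_decay_mul_id, Ai_fast_decay.
  - intros x hx. assert (h1 := proj2 (decaying_Ai1 s) x hx).
    apply (continuous_plus (V := R_NormedModule) (fun x => Ai1 x + Ai1 x) (fun x => x * Ai2 x)).
    + exact (continuous_plus (V := R_NormedModule) Ai1 Ai1 x h1 h1).
    + apply Rmult_continuous; [apply continuous_id|now apply (decaying_Ai2 s)].
Qed.

(** * Wronskian identities for the kernel *)

Lemma is_derive_Rmult (f g : R -> R) (x lf lg : R) :
  is_derive f x lf -> is_derive g x lg -> is_derive (fun t => f t * g t) x (lf * g x + f x * lg).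
Proof. intros hf hg. apply (is_derive_mult f g x lf lg hf hg), Rmult_comm. Qed.

(** The products of first derivatives cancel, and the Airy equation leaves the factor (x + t) - (y +
    t), from which [t] drops out. *)
Lemma is_derive_shift_wronskian (x y t : R) :
  is_derive (fun t => Ai1 (x + t) * Ai (y + t) - Ai (x + t) * Ai1 (y + t)) t
    ((x - y) * (Ai (x + t) * Ai (y + t))).
Proof.
  replace ((x - y) * (Ai (x + t) * Ai (y + t))) with
    ((Ai2 (x + t) * Ai (y + t) + Ai1 (x + t) * Ai1 (y + t))
     - (Ai1 (x + t) * Ai1 (y + t) + Ai (x + t) * Ai2 (y + t))) by (unfold Ai2; ring).
  apply (is_derive_minus (K := R_AbsRing) (V := R_NormedModule)).
  - apply (is_derive_Rmult (fun t => Ai1 (x + t)) (fun t => Ai (y + t)));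
      apply (fun h => proj2 (is_derive_shift _ _ _ _ h)); [apply airy_equation|apply is_derive_Ai].
  - apply (is_derive_Rmult (fun t => Ai (x + t)) (fun t => Ai1 (y + t)));
      apply (fun h => proj2 (is_derive_shift _ _ _ _ h)); [apply is_derive_Ai|apply airy_equation].
Qed.

Lemma shift_wronskian_decay (x y : R) : exists C, 0 < C /\ forall t, 0 < t ->
  Rabs (Ai1 (x + t) * Ai (y + t) - Ai (x + t) * Ai1 (y + t)) <= C * exp (- (2 * t)).
Proof.
  (* Any point to the left of both [x] and [y] serves; it only makes the half-line estimates
     applicable. *)
  set (s := Rmin x y - 1).
  assert (hx : s < x) by (unfold s; generalize (Rmin_l x y); lra).
  assert (hy : s < y) by (unfold s; generalize (Rmin_r x y); lra).
  destruct (shift_prod_decay s Ai1 Ai 1 (decaying_Ai1 s) (decaying_Ai s) (Rle_refl 1)) as [A [hA HA]].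
  destruct (shift_prod_decay s Ai Ai1 1 (decaying_Ai s) (decaying_Ai1 s) (Rle_refl 1)) as [B [hB HB]].
  exists ((A + B) * exp (- 1 * (y - s))).
  split; [apply Rmult_lt_0_compat; [lra|apply exp_pos]|].
  intros t ht. unfold Rminus at 1. eapply Rle_trans; [apply Rabs_triang|]. rewrite Rabs_Ropp.
  rewrite !Rmult_plus_distr_r. apply Rplus_le_compat; [now apply HA|now apply HB].
Qed.

Lemma shift_conv_Ai_Ai (x y : R) :
  (x - y) * shift_conv Ai Ai x y = Ai x * Ai1 y - Ai1 x * Ai y.
Proof.
  set (s := Rmin x y - 1).
  assert (hx : s < x) by (unfold s; generalize (Rmin_l x y); lra).
  assert (hy : s < y) by (unfold s; generalize (Rmin_r x y); lra).
  assert (h1 := is_RInt_gen_scal (V := R_NormedModule) _ (x - y) _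
    (is_RInt_gen_shift_conv s x y Ai Ai (decaying_Ai s) (decaying_Ai s) hx hy)).
  apply half_int_unique in h1. etransitivity; [symmetry; exact h1|].
  apply half_int_unique.
  replace (Ai x * Ai1 y - Ai1 x * Ai y) with (0 - (Ai1 x * Ai y - Ai x * Ai1 y)) by ring.
  apply (is_RInt_gen_primitive 0 _
    (fun t => Ai1 (x + t) * Ai (y + t) - Ai (x + t) * Ai1 (y + t))).
  - intros t ht. apply (Rmult_continuous (fun _ => x - y)); [apply continuous_const|].
    apply (continuous_shift_prod s x y Ai Ai); auto using decaying_Ai.
  - intros t ht. apply is_derive_shift_wronskian.
  - apply (filterlim_at_right_continuous
      (fun t => Ai1 (x + t) * Ai (y + t) - Ai (x + t) * Ai1 (y + t))).
    + exact (is_derive_continuous _ _ _ (is_derive_shift_wronskian x y 0)).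
    + now rewrite !Rplus_0_r.
  - destruct (shift_wronskian_decay x y) as [C [hC H]].
    apply (filterlim_0_squeeze _ _ (fun t => C * exp (- (t - 0)))); [|apply exp_decay_infty].
    exists 0. intros t ht. eapply Rle_trans; [now apply H|]. eapply Rle_trans; [|apply Rle_abs].
    apply Rmult_le_compat_l; [lra|]. apply exp_nondecreasing. lra.
Qed.

(* The difference of the two integrands is the t-derivative of t times the shifted Wronskian. *)
Lemma shift_conv_L_symmetric (s x y : R) : s < x -> s < y ->
  (x - s) * shift_conv Ai2 Ai x y + shift_conv Ai1 Ai x y - x * (x - s) * shift_conv Ai Ai x y
  = (y - s) * shift_conv Ai Ai2 x y + shift_conv Ai Ai1 x y - y * (y - s) * shift_conv Ai Ai x y.
Proof.
  intros hx hy.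
  set (W := fun t => Ai1 (x + t) * Ai (y + t) - Ai (x + t) * Ai1 (y + t)).
  assert (hz : is_RInt_gen (fun t => W t + t * ((x - y) * (Ai (x + t) * Ai (y + t))))
    (at_right 0) (Rbar_locally p_infty) (0 - 0)).
  { apply (is_RInt_gen_primitive 0 _ (fun t => t * W t)).
    - intros t ht. apply (continuous_plus (V := R_NormedModule)).
      + exact (is_derive_continuous _ _ _ (is_derive_shift_wronskian x y t)).
      + apply Rmult_continuous; [apply continuous_id|].
        apply (Rmult_continuous (fun _ => x - y)); [apply continuous_const|].
        apply (continuous_shift_prod s x y Ai Ai); auto using decaying_Ai.
    - intros t ht. exact (is_derive_mul_id W t _ (is_derive_shift_wronskian x y t)).
    - apply (filterlim_at_right_continuous (fun t => t * W t)); [|ring].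
      exact (is_derive_continuous _ _ _ (is_derive_mul_id W 0 _ (is_derive_shift_wronskian x y 0))).
    - destruct (shift_wronskian_decay x y) as [C [hC H]].
      apply (filterlim_0_squeeze _ _ (fun t => C * exp (- (t - 0)))); [|apply exp_decay_infty].
      exists 0. intros t ht. rewrite Rabs_mult, (Rabs_right t) by lra.
      apply Rle_trans with (t * (C * exp (- (2 * t)))).
      + apply Rmult_le_compat_l; [lra|]. exact (H t ht).
      + eapply Rle_trans; [|apply Rle_abs].
        replace (- (2 * t)) with (- t + - (t - 0)) by ring. rewrite exp_plus.
        assert (ht1 : t * exp (- t) <= 1).
        { rewrite exp_Ropp. apply Rmult_le_reg_r with (exp t); [apply exp_pos|].
          rewrite Rmult_assoc, Rinv_l by (generalize (exp_pos t); lra).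
          generalize (exp_ge_1_plus t). lra. }
        assert (hp := Rmult_lt_0_compat _ _ hC (exp_pos (- (t - 0)))). nra. }
  assert (d0 := decaying_Ai s). assert (d1 := decaying_Ai1 s). assert (d2 := decaying_Ai2 s).
  assert (I00 := is_RInt_gen_shift_conv s x y Ai Ai d0 d0 hx hy).
  assert (I10 := is_RInt_gen_shift_conv s x y Ai1 Ai d1 d0 hx hy).
  assert (I01 := is_RInt_gen_shift_conv s x y Ai Ai1 d0 d1 hx hy).
  assert (I20 := is_RInt_gen_shift_conv s x y Ai2 Ai d2 d0 hx hy).
  assert (I02 := is_RInt_gen_shift_conv s x y Ai Ai2 d0 d2 hx hy).
  assert (hL := is_RInt_gen_plus (V := R_NormedModule) _ _ _ _
    (is_RInt_gen_scal (V := R_NormedModule) _ (x - s) _ I20)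
    (is_RInt_gen_minus (V := R_NormedModule) _ _ _ _ I10
      (is_RInt_gen_scal (V := R_NormedModule) _ (x * (x - s)) _ I00))).
  assert (hR := is_RInt_gen_plus (V := R_NormedModule) _ _ _ _
    (is_RInt_gen_scal (V := R_NormedModule) _ (y - s) _ I02)
    (is_RInt_gen_minus (V := R_NormedModule) _ _ _ _ I01
      (is_RInt_gen_scal (V := R_NormedModule) _ (y * (y - s)) _ I00))).
  assert (hdiff := is_RInt_gen_minus (V := R_NormedModule) _ _ _ _ hL hR).
  apply (is_RInt_gen_ext (V := R_NormedModule) _
    (fun t => W t + t * ((x - y) * (Ai (x + t) * Ai (y + t))))) in hdiff.
  (* Since [Ai2 (x + t)] is [(x + t) * Ai (x + t)], the part [- x * (x - s)] of the potential
     reduces the second-order term to [t * (x - s)]; the same happens in [y], and the difference is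
     [t * (x - y)]. *)
  2:{ apply filter_forall. intros ab t _. unfold W, Ai2, minus, plus, opp, scal; simpl.
      unfold mult; simpl. ring. }
  apply half_int_unique in hz. apply half_int_unique in hdiff.
  assert (h := eq_trans (eq_sym hz) hdiff).
  unfold minus, plus, opp, scal in h; simpl in h. unfold mult in h; simpl in h. lra.
Qed.

(** * Commutation for real functions *)

Record real_admissible (s : R) (f f1 f2 : R -> R) : Prop := {
  radm_derive1 : derives s f f1;
  radm_derive2 : derives s f1 f2;
  radm_continuous2 : forall y, s < y -> continuous f2 y;
  radm_left : filterlim (fun y => (y - s) * f1 y) (at_right s) (locally 0);
  radm_infty : exists a M, Rbar_locally p_infty (fun y =>
    Rabs (f y) <= M * exp (a * y) /\ Rabs (f1 y) <= M * exp (a * y))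
}.

(** One majorant for f on the whole half-line: the inverse square root covers the end [s], the
    exponential covers infinity. Multiplied by [exp (- (b + 1) * (y - s))] it is the left side of
    [singular_exp_le_weight], up to the constant. *)
Definition singular_growth (s B b y : R) : R := B * ((1 + / sqrt (y - s)) * exp (b * (y - s))).

Lemma sqrt_inv_pos (s y : R) : s < y -> 0 < / sqrt (y - s).
Proof. intros h. apply Rinv_0_lt_compat, sqrt_lt_R0. lra. Qed.

Lemma singular_growth_ge (s B b y v : R) : s < y -> 0 <= b ->
  v <= B * (1 + / sqrt (y - s)) -> 0 <= B -> v <= singular_growth s B b y.
Proof.
  intros hy hb hv hB. eapply Rle_trans; [exact hv|]. unfold singular_growth.
  apply Rmult_le_compat_l; [exact hB|]. rewrite <- Rmult_1_r at 1.
  apply Rmult_le_compat_l; [generalize (sqrt_inv_pos s y hy); lra|].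
  rewrite <- exp_0. apply exp_nondecreasing. apply Rmult_le_pos; lra.
Qed.

(* Near s, |f'| <= 1/(y - s) <= (y - s)^(-3/2), whose primitive is -2 (y - s)^(-1/2). *)
Lemma radm_bound_left (s : R) (f f1 f2 : R -> R) : real_admissible s f f1 f2 ->
  exists c B, s < c /\ 0 < B /\ forall y, s < y <= c -> Rabs (f y) <= B * (1 + / sqrt (y - s)).
Proof.
  intros h.
  destruct (filterlim_0_abs _ _ (radm_left _ _ _ _ h) 1 Rlt_0_1) as [e He].
  (* The half keeps [c] strictly inside the ball of radius [e]; the cap 1 gives [sqrt (t - s) <= 1],
     which turns 1/(t - s) into a bound by (t - s)^(-3/2). *)
  set (c := s + Rmin (e / 2) 1).
  assert (hm : 0 < Rmin (e / 2) 1) by (apply Rmin_glb_lt; [generalize (cond_pos e)|]; lra).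
  assert (hm1 := Rmin_l (e / 2) 1). assert (hm2 := Rmin_r (e / 2) 1).
  assert (hce : c - s < e) by (unfold c; generalize (cond_pos e); lra).
  assert (hsc : s < c) by (unfold c; lra). assert (hc1 : c - s <= 1) by (unfold c; lra).
  exists c, (Rabs (f c) + 2). split; [exact hsc|]. split; [generalize (Rabs_pos (f c)); lra|].
  intros y hy.
  assert (hb : forall t, s < t <= c -> Rabs (f1 t) <= / ((t - s) * sqrt (t - s))).
  { intros t ht.
    assert (h1 : Rabs ((t - s) * f1 t) < 1).
    { apply He; [|lra].
      unfold ball; simpl; unfold AbsRing_ball, abs, minus, plus, opp; simpl.
      change (t + - s) with (t - s). rewrite Rabs_right; lra. }
    rewrite Rabs_mult, (Rabs_right (t - s)) in h1 by lra.
    assert (h2 : 0 < sqrt (t - s)) by (apply sqrt_lt_R0; lra).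
    assert (h3 : sqrt (t - s) <= 1) by (rewrite <- sqrt_1; apply sqrt_le_1_alt; lra).
    assert (h4 : 0 < (t - s) * sqrt (t - s)) by (apply Rmult_lt_0_compat; lra).
    apply Rmult_le_reg_r with ((t - s) * sqrt (t - s)); [exact h4|].
    rewrite Rinv_l by lra. generalize (Rabs_pos (f1 t)). nra. }
  assert (hd : forall t, s < t -> is_derive (fun t => - (2 * / sqrt (t - s))) t
    (/ ((t - s) * sqrt (t - s)))).
  { intros t ht. assert (h2 : 0 < sqrt (t - s)) by (apply sqrt_lt_R0; lra).
    auto_derive; change (t + - s) with (t - s).
    - repeat split; lra.
    - rewrite <- (sqrt_sqrt (t - s)) at 4 by lra. field. lra. }
  assert (hp : - (2 * / sqrt (y - s)) + f y <= - (2 * / sqrt (c - s)) + f c).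
  { apply (nondecreasing_of_derive (fun t => - (2 * / sqrt (t - s)) + f t)
      (fun t => / ((t - s) * sqrt (t - s)) + f1 t)); [| |lra].
    - intros t ht. apply (is_derive_plus (K := R_AbsRing) (V := R_NormedModule)).
      + apply hd. lra.
      + apply (radm_derive1 _ _ _ _ h). lra.
    - intros t ht. generalize (hb t ltac:(lra)) (Rle_abs (- f1 t)). rewrite Rabs_Ropp. lra. }
  assert (hn : - (2 * / sqrt (y - s)) - f y <= - (2 * / sqrt (c - s)) - f c).
  { apply (nondecreasing_of_derive (fun t => - (2 * / sqrt (t - s)) - f t)
      (fun t => / ((t - s) * sqrt (t - s)) - f1 t)); [| |lra].
    - intros t ht. apply (is_derive_minus (K := R_AbsRing) (V := R_NormedModule)).
      + apply hd. lra.
      + apply (radm_derive1 _ _ _ _ h). lra.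
    - intros t ht. generalize (hb t ltac:(lra)) (Rle_abs (f1 t)). lra. }
  assert (h5 := sqrt_inv_pos s c hsc). assert (h6 := sqrt_inv_pos s y ltac:(lra)).
  assert (h7 := Rabs_pos (f c)).
  apply Rle_trans with (Rabs (f c) + 2 * / sqrt (y - s)); [|nra].
  generalize (Rle_abs (f c)) (Rle_abs (- f c)). rewrite Rabs_Ropp. intros.
  apply Rabs_le. lra.
Qed.

Lemma radm_bound_compact (s c N : R) (f f1 f2 : R -> R) : real_admissible s f f1 f2 -> s < c ->
  exists B, 0 <= B /\ forall y, c <= y <= N -> Rabs (f y) <= B.
Proof.
  intros h hc. destruct (Rle_or_lt c N) as [hN|hN].
  - destruct (continuity_ab_maj (fun y => Rabs (f y)) c N hN) as [m [hm _]].
    + intros y hy. apply (continuity_pt_comp f Rabs); [|apply Rcontinuity_abs].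
      apply continuity_pt_filterlim.
      refine (is_derive_continuous _ _ _ (radm_derive1 _ _ _ _ h y _)). lra.
    + exists (Rabs (f m)). split; [apply Rabs_pos|exact hm].
  - exists 0. split; [lra|]. intros y hy. lra.
Qed.

(** Three ranges are glued: near [s], a compact middle part where f is continuous, and the range of
    the growth condition. The sum of the three constants dominates on each. *)
Lemma radm_growth (s : R) (f f1 f2 : R -> R) : real_admissible s f f1 f2 ->
  exists B b, 0 < B /\ 0 <= b /\ (forall y, s < y -> Rabs (f y) <= singular_growth s B b y) /\
    Rbar_locally p_infty (fun y => Rabs (f1 y) <= B * exp (b * (y - s))).
Proof.
  intros h. destruct (radm_bound_left s f f1 f2 h) as [c [B1 [hc [hB1 H1]]]].
  destruct (radm_infty _ _ _ _ h) as [a [M [N HN]]].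
  destruct (radm_bound_compact s c (Rmax N s + 1) f f1 f2 h hc) as [B2 [hB2 H2]].
  (* The factor [exp (a * s)] recentres the exponential at [s]; the rate then becomes [Rabs a], so
     that it is nonnegative. *)
  set (M' := Rabs M * exp (a * s)).
  assert (hM' : 0 <= M') by (apply Rmult_le_pos; [apply Rabs_pos|left; apply exp_pos]).
  assert (hexp : forall y, s < y -> M * exp (a * y) <= M' * exp (Rabs a * (y - s))).
  { intros y hy. unfold M'. rewrite Rmult_assoc, <- exp_plus.
    apply Rle_trans with (Rabs M * exp (a * y)).
    - apply Rmult_le_compat_r; [left; apply exp_pos|apply Rle_abs].
    - apply Rmult_le_compat_l; [apply Rabs_pos|]. apply exp_nondecreasing.
      generalize (Rle_abs a). nra. }
  assert (hmx1 := Rmax_l N s). assert (hmx2 := Rmax_r N s).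
  exists (B1 + B2 + M'), (Rabs a). split; [lra|]. split; [apply Rabs_pos|]. split.
  - intros y hy. assert (hq := sqrt_inv_pos s y hy).
    destruct (Rle_or_lt y c) as [hyc|hyc].
    { apply singular_growth_ge; [exact hy|apply Rabs_pos| |lra].
      eapply Rle_trans; [apply H1; lra|]. apply Rmult_le_compat_r; lra. }
    destruct (Rle_or_lt y (Rmax N s + 1)) as [hyN|hyN].
    { apply singular_growth_ge; [exact hy|apply Rabs_pos| |lra].
      eapply Rle_trans; [apply H2; lra|]. nra. }
    eapply Rle_trans; [apply HN; lra|]. eapply Rle_trans; [now apply hexp|].
    unfold singular_growth. assert (he := exp_pos (Rabs a * (y - s))).
    apply Rmult_le_compat; try lra. nra.
  - exists (Rmax N s). intros y hy. eapply Rle_trans; [apply HN; lra|].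
    eapply Rle_trans; [apply hexp; lra|].
    apply Rmult_le_compat_r; [left; apply exp_pos|lra].
Qed.

(** The boundary term at [s] contains f as well as f', and admissibility speaks only of f'. The
    inverse square root bound leaves at most a multiple of [(y - s) + sqrt (y - s)]. *)
Lemma radm_left_f (s : R) (f f1 f2 : R -> R) : real_admissible s f f1 f2 ->
  filterlim (fun y => (y - s) * f y) (at_right s) (locally 0).
Proof.
  intros h. destruct (radm_bound_left s f f1 f2 h) as [c [B [hc [hB H]]]].
  apply (filterlim_0_squeeze _ _ (fun y => B * ((y - s) + sqrt (y - s)))).
  - generalize (at_right_lt s c hc). apply filter_imp. intros y hy.
    eapply Rle_trans; [|apply Rle_abs]. rewrite Rabs_mult, (Rabs_right (y - s)) by lra.
    apply Rle_trans with ((y - s) * (B * (1 + / sqrt (y - s)))).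
    + apply Rmult_le_compat_l; [lra|]. apply H. lra.
    + assert (h2 : 0 < sqrt (y - s)) by (apply sqrt_lt_R0; lra). right.
      rewrite <- (sqrt_sqrt (y - s)) at 1 3 by lra. field. lra.
  - apply (filterlim_at_right_continuous (fun y => B * ((y - s) + sqrt (y - s))));
      [|rewrite Rminus_diag, sqrt_0; ring].
    apply (Rmult_continuous (fun _ => B)); [apply continuous_const|].
    assert (hcm : continuous (fun y => y - s) s).
    { apply (continuous_minus (V := R_NormedModule)); [apply continuous_id|apply continuous_const]. }
    apply (continuous_plus (V := R_NormedModule)); [exact hcm|].
    apply (continuous_comp (fun y => y - s) sqrt); [exact hcm|]. apply continuous_sqrt.
Qed.

(** The kernel is taken with rate [c + 1]: [c] cancels the growth of f and the remaining unit feeds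
    the weight. Uniformity in [x] permits differentiation under the integral. *)
Lemma shift_conv_mul_weight (s : R) (a b f f1 f2 : R -> R) :
  decaying s a -> decaying s b -> real_admissible s f f1 f2 ->
  exists M, 0 < M /\ forall x y, s < x -> s < y ->
    Rabs (shift_conv a b x y * f y) <= M * weight s y.
Proof.
  intros ha hb h. destruct (radm_growth s f f1 f2 h) as [B [c [hB [hc [H _]]]]].
  destruct (shift_conv_decay s a b (c + 1) ha hb) as [C [hC H']]; [lra|].
  exists (C * B * weight_const).
  split; [apply Rmult_lt_0_compat; [now apply Rmult_lt_0_compat|apply weight_const_pos]|].
  intros x y hx hy. rewrite Rabs_mult.
  apply Rle_trans with ((C * exp (- (c + 1) * (y - s))) * singular_growth s B c y).
  { apply Rmult_le_compat; try apply Rabs_pos; auto. }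
  unfold singular_growth.
  replace (C * exp (- (c + 1) * (y - s)) * (B * ((1 + / sqrt (y - s)) * exp (c * (y - s)))))
    with (C * B * ((1 + / sqrt (y - s)) * (exp (- (c + 1) * (y - s)) * exp (c * (y - s))))) by ring.
  rewrite <- exp_plus. replace (- (c + 1) * (y - s) + c * (y - s)) with (- (y - s)) by ring.
  rewrite (Rmult_assoc (C * B)). apply Rmult_le_compat_l; [nra|].
  now apply singular_exp_le_weight.
Qed.

Lemma continuous_shift_conv_mul (s x y : R) (a b b1 b2 f f1 f2 : R -> R) :
  decaying s a -> decaying s b -> decaying s b1 -> decaying s b2 ->
  derives s b b1 -> derives s b1 b2 -> real_admissible s f f1 f2 -> s < x -> s < y ->
  continuous (fun y => shift_conv a b x y * f y) y.
Proof.
  intros ha hb hb1 hb2 d1 d2 h hx hy. apply Rmult_continuous.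
  - exact (is_derive_continuous _ _ _
      (is_derive_shift_conv_r s a b b1 b2 x y ha hb hb1 hb2 d1 d2 hx hy)).
  - exact (is_derive_continuous _ _ _ (radm_derive1 _ _ _ _ h y hy)).
Qed.

(** For [a = Ai] this is K f without the factor lambda; [Ai1] and [Ai2] in place of [a] give its
    first two derivatives in [x]. *)
Definition shift_op (s : R) (a f : R -> R) (x : R) : R :=
  half_int s (fun y => shift_conv a Ai x y * f y).

Lemma continuous_shift_conv_Ai_mul (s x y : R) (a f f1 f2 : R -> R) :
  decaying s a -> real_admissible s f f1 f2 -> s < x -> s < y ->
  continuous (fun y => shift_conv a Ai x y * f y) y.
Proof.
  intros. apply (continuous_shift_conv_mul s x y a Ai Ai1 Ai2 f f1 f2);
    auto using decaying_Ai, decaying_Ai1, decaying_Ai2, derives_Ai, derives_Ai1.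
Qed.

Lemma is_RInt_gen_shift_op (s x : R) (a f f1 f2 : R -> R) :
  decaying s a -> real_admissible s f f1 f2 -> s < x ->
  is_RInt_gen (fun y => shift_conv a Ai x y * f y) (at_right s) (Rbar_locally p_infty)
    (shift_op s a f x).
Proof.
  intros ha h hx. destruct (shift_conv_mul_weight s a Ai f f1 f2 ha (decaying_Ai s) h) as [M [_ H]].
  apply (half_int_dominated s M).
  - intros y hy. now apply (continuous_shift_conv_Ai_mul s x y a f f1 f2).
  - intros y hy. now apply H.
Qed.

Lemma is_derive_shift_op (s x : R) (a a1 a2 a3 f f1 f2 : R -> R) :
  decaying s a -> decaying s a1 -> decaying s a2 -> decaying s a3 ->
  derives s a a1 -> derives s a1 a2 -> derives s a2 a3 -> real_admissible s f f1 f2 -> s < x ->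
  is_derive (shift_op s a f) x (shift_op s a1 f x).
Proof.
  intros ha ha1 ha2 ha3 d1 d2 d3 h hx.
  assert (hA := decaying_Ai s).
  destruct (shift_conv_mul_weight s a Ai f f1 f2 ha hA h) as [C0 [p0 B0]].
  destruct (shift_conv_mul_weight s a1 Ai f f1 f2 ha1 hA h) as [C1 [p1 B1]].
  destruct (shift_conv_mul_weight s a2 Ai f f1 f2 ha2 hA h) as [C2 [p2 B2]].
  apply (is_derive_half_int s (C0 + C1 + C2) x (x - s)
    (fun z y => shift_conv a Ai z y * f y) (fun z y => shift_conv a1 Ai z y * f y)
    (fun z y => shift_conv a2 Ai z y * f y)); try lra.
  - intros z y hz hy. apply Rabs_lt_ball in hz.
    apply is_derive_mult_l, (is_derive_shift_conv_l s a a1 a2 Ai); auto.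
  - intros z y hz hy. apply Rabs_lt_ball in hz.
    apply is_derive_mult_l, (is_derive_shift_conv_l s a1 a2 a3 Ai); auto.
  - intros z y hz hy. apply Rabs_lt_ball in hz.
    now apply (continuous_shift_conv_Ai_mul s z y a f f1 f2).
  - intros y hy. now apply (continuous_shift_conv_Ai_mul s x y a1 f f1 f2).
  - intros z y hz hy. apply Rabs_lt_ball in hz.
    generalize (B0 z y hz hy) (weight_pos s y hy). nra.
  - intros y hy. generalize (B1 x y hx hy) (weight_pos s y hy). nra.
  - intros z y hz hy. apply Rabs_lt_ball in hz.
    generalize (B2 z y hz hy) (weight_pos s y hy). nra.
Qed.

Lemma is_derive_shift_op_Ai (s x : R) (f f1 f2 : R -> R) : real_admissible s f f1 f2 -> s < x ->
  is_derive (shift_op s Ai f) x (shift_op s Ai1 f x).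
Proof.
  intros. apply (is_derive_shift_op s x Ai Ai1 Ai2 Ai3 f f1 f2);
    auto using decaying_Ai, decaying_Ai1, decaying_Ai2, decaying_Ai3, derives_Ai, derives_Ai1, derives_Ai2.
Qed.

Lemma is_derive_shift_op_Ai1 (s x : R) (f f1 f2 : R -> R) : real_admissible s f f1 f2 -> s < x ->
  is_derive (shift_op s Ai1 f) x (shift_op s Ai2 f x).
Proof.
  intros. apply (is_derive_shift_op s x Ai1 Ai2 Ai3 Ai4 f f1 f2);
    auto using decaying_Ai1, decaying_Ai2, decaying_Ai3, decaying_Ai4, derives_Ai1, derives_Ai2, derives_Ai3.
Qed.

(** * Boundary terms and integration by parts *)

Lemma boundary_term_left (s x : R) (f f1 f2 : R -> R) : real_admissible s f f1 f2 -> s < x ->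
  filterlim (fun y => (y - s) * (shift_conv Ai Ai x y * f1 y - shift_conv Ai Ai1 x y * f y))
    (at_right s) (locally 0).
Proof.
  intros h hx.
  (* Near [s] the kernel and its y-derivative are merely bounded; the smallness comes from
     [(y - s) * f1 y] and [(y - s) * f y]. *)
  assert (hb : forall b, decaying s b -> exists C, 0 < C /\
    forall y, s < y -> Rabs (shift_conv Ai b x y) <= C).
  { intros b hb. destruct (shift_conv_decay s Ai b 1 (decaying_Ai s) hb (Rle_refl 1)) as [C [hC H]].
    exists C. split; [exact hC|]. intros y hy. eapply Rle_trans; [now apply H|].
    rewrite <- (Rmult_1_r C) at 2. apply Rmult_le_compat_l; [lra|].
    apply Rle_trans with (exp 0); [apply exp_nondecreasing; lra|rewrite exp_0; lra]. }
  destruct (hb Ai (decaying_Ai s)) as [C [hC HC]].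
  destruct (hb Ai1 (decaying_Ai1 s)) as [D [hD HD]].
  apply filterlim_0_eps; [apply at_right_proper_filter|]. intros eps. assert (he := cond_pos eps).
  assert (e1 : 0 < eps / (2 * C)) by (apply Rdiv_lt_0_compat; lra).
  assert (e2 : 0 < eps / (2 * D)) by (apply Rdiv_lt_0_compat; lra).
  generalize (filter_and _ _ (at_right_gt s) (filter_and _ _
    (filterlim_0_abs _ _ (radm_left _ _ _ _ h) _ e1)
    (filterlim_0_abs _ _ (radm_left_f _ _ _ _ h) _ e2))).
  apply filter_imp. intros y [hy [h1 h2]].
  replace ((y - s) * (shift_conv Ai Ai x y * f1 y - shift_conv Ai Ai1 x y * f y))
    with (shift_conv Ai Ai x y * ((y - s) * f1 y) + - (shift_conv Ai Ai1 x y * ((y - s) * f y))) by ring.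
  eapply Rle_trans; [apply Rabs_triang|]. rewrite Rabs_Ropp, !(Rabs_mult (shift_conv _ _ _ _)).
  replace (pos eps) with (C * (eps / (2 * C)) + D * (eps / (2 * D))) by (field; lra).
  apply Rplus_le_compat; apply Rmult_le_compat; try apply Rabs_pos; try lra; auto.
Qed.

(** The kernel is taken with rate [b + 2]: [b] cancels the growth of f and f', one unit absorbs the
    factor [y - s], and one is left to tend to 0. *)
Lemma boundary_term_infty (s x : R) (f f1 f2 : R -> R) : real_admissible s f f1 f2 -> s < x ->
  filterlim (fun y => (y - s) * (shift_conv Ai Ai x y * f1 y - shift_conv Ai Ai1 x y * f y))
    (Rbar_locally p_infty) (locally 0).
Proof.
  intros h hx. destruct (radm_growth s f f1 f2 h) as [B [b [hB [hb [H [N HN]]]]]].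
  destruct (shift_conv_decay s Ai Ai (b + 2) (decaying_Ai s) (decaying_Ai s)) as [C [hC HC]]; [lra|].
  destruct (shift_conv_decay s Ai Ai1 (b + 2) (decaying_Ai s) (decaying_Ai1 s)) as [D [hD HD]]; [lra|].
  apply (filterlim_0_squeeze _ _ (fun y => (2 * (C + D) * B) * exp (- (y - s)))); [|apply exp_decay_infty].
  exists (Rmax N (s + 1)). intros y hy.
  assert (hm1 := Rmax_l N (s + 1)). assert (hm2 := Rmax_r N (s + 1)).
  assert (hys : s < y) by lra.
  eapply Rle_trans; [|apply Rle_abs].
  set (E := exp (- (b + 2) * (y - s))) in *. set (G := exp (b * (y - s))).
  assert (hE : 0 < E) by apply exp_pos. assert (hG : 0 < G) by apply exp_pos.
  assert (hf1 : Rabs (f1 y) <= B * G) by (apply HN; lra).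
  assert (hf : Rabs (f y) <= 2 * B * G).
  { eapply Rle_trans; [now apply H|]. unfold singular_growth. fold G.
    assert (hq : / sqrt (y - s) <= 1).
    { rewrite <- Rinv_1. apply Rinv_le_contravar; [lra|].
      rewrite <- sqrt_1. apply sqrt_le_1_alt. lra. }
    replace (2 * B * G) with (B * (2 * G)) by ring. apply Rmult_le_compat_l; [lra|].
    apply Rmult_le_compat_r; lra. }
  assert (hk0 := HC x y hx hys). assert (hk1 := HD x y hx hys). fold E in hk0, hk1.
  rewrite Rabs_mult, (Rabs_right (y - s)) by lra.
  assert (hsum : Rabs (shift_conv Ai Ai x y * f1 y - shift_conv Ai Ai1 x y * f y)
    <= 2 * (C + D) * B * (E * G)).
  { unfold Rminus. eapply Rle_trans; [apply Rabs_triang|]. rewrite Rabs_Ropp, !Rabs_mult.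
    apply Rle_trans with ((C * E) * (B * G) + (D * E) * (2 * B * G)).
    - apply Rplus_le_compat; apply Rmult_le_compat; try apply Rabs_pos; assumption.
    - assert (0 < C * B * (E * G)) by (repeat apply Rmult_lt_0_compat; lra). lra. }
  assert (hEG : E * G = exp (- (y - s)) * exp (- (y - s))).
  { unfold E, G. rewrite <- !exp_plus. f_equal. ring. }
  assert (ht1 : (y - s) * exp (- (y - s)) <= 1).
  { rewrite exp_Ropp. apply Rmult_le_reg_r with (exp (y - s)); [apply exp_pos|].
    rewrite Rmult_assoc, Rinv_l by (generalize (exp_pos (y - s)); lra).
    generalize (exp_ge_1_plus (y - s)). lra. }
  apply Rle_trans with ((y - s) * (2 * (C + D) * B * (E * G))); [apply Rmult_le_compat_l; lra|].
  rewrite hEG.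
  replace ((y - s) * (2 * (C + D) * B * (exp (- (y - s)) * exp (- (y - s)))))
    with (2 * (C + D) * B * exp (- (y - s)) * ((y - s) * exp (- (y - s)))) by ring.
  rewrite <- (Rmult_1_r (2 * (C + D) * B * exp (- (y - s)))) at 2.
  apply Rmult_le_compat_l; [|exact ht1].
  apply Rmult_le_pos; [nra|left; apply exp_pos].
Qed.

(** Lagrange's identity: the integrand is k L f - f L_y k, in which the potential terms cancel, and
    it is the derivative of (y - s)(k f' - k_y f). Both integrations by parts are thus done at
    once. *)
Lemma is_RInt_gen_boundary (s x : R) (f f1 f2 : R -> R) : real_admissible s f f1 f2 -> s < x ->
  is_RInt_gen (fun y =>
      (shift_conv Ai Ai x y * f1 y - shift_conv Ai Ai1 x y * f y)
      + (y - s) * (shift_conv Ai Ai x y * f2 y - shift_conv Ai Ai2 x y * f y))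
    (at_right s) (Rbar_locally p_infty) 0.
Proof.
  intros h hx. replace 0 with (0 - 0) at 1 by ring.
  assert (d0 := decaying_Ai s). assert (d1 := decaying_Ai1 s). assert (d2 := decaying_Ai2 s).
  assert (d3 := decaying_Ai3 s). assert (d4 := decaying_Ai4 s).
  assert (e0 := derives_Ai s). assert (e1 := derives_Ai1 s). assert (e2 := derives_Ai2 s).
  assert (e3 := derives_Ai3 s).
  assert (k0 : forall y, s < y -> is_derive (shift_conv Ai Ai x) y (shift_conv Ai Ai1 x y)).
  { intros y hy. now apply (is_derive_shift_conv_r s Ai Ai Ai1 Ai2). }
  assert (k1 : forall y, s < y -> is_derive (shift_conv Ai Ai1 x) y (shift_conv Ai Ai2 x y)).
  { intros y hy. now apply (is_derive_shift_conv_r s Ai Ai1 Ai2 Ai3). }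
  assert (k2 : forall y, s < y -> is_derive (shift_conv Ai Ai2 x) y (shift_conv Ai Ai3 x y)).
  { intros y hy. now apply (is_derive_shift_conv_r s Ai Ai2 Ai3 Ai4). }
  assert (g1 := radm_derive1 _ _ _ _ h). assert (g2 := radm_derive2 _ _ _ _ h).
  apply (is_RInt_gen_primitive s _
    (fun y => (y - s) * (shift_conv Ai Ai x y * f1 y - shift_conv Ai Ai1 x y * f y))).
  - intros y hy.
    assert (c0 := is_derive_continuous _ _ _ (k0 y hy)).
    assert (c1 := is_derive_continuous _ _ _ (k1 y hy)).
    assert (c2 := is_derive_continuous _ _ _ (k2 y hy)).
    assert (cf := is_derive_continuous _ _ _ (g1 y hy)).
    assert (cf1 := is_derive_continuous _ _ _ (g2 y hy)).
    assert (cf2 := radm_continuous2 _ _ _ _ h y hy).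
    apply (continuous_plus (V := R_NormedModule)).
    + apply (continuous_minus (V := R_NormedModule)); now apply Rmult_continuous.
    + apply Rmult_continuous.
      * apply (continuous_minus (V := R_NormedModule)); [apply continuous_id|apply continuous_const].
      * apply (continuous_minus (V := R_NormedModule)); now apply Rmult_continuous.
  - intros y hy.
    replace ((shift_conv Ai Ai x y * f1 y - shift_conv Ai Ai1 x y * f y)
      + (y - s) * (shift_conv Ai Ai x y * f2 y - shift_conv Ai Ai2 x y * f y))
      with (1 * (shift_conv Ai Ai x y * f1 y - shift_conv Ai Ai1 x y * f y)
      + (y - s) * ((shift_conv Ai Ai1 x y * f1 y + shift_conv Ai Ai x y * f2 y)
                  - (shift_conv Ai Ai2 x y * f y + shift_conv Ai Ai1 x y * f1 y))) by ring.
    apply (is_derive_Rmult (fun y => y - s)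
      (fun y => shift_conv Ai Ai x y * f1 y - shift_conv Ai Ai1 x y * f y)).
    + auto_derive; [easy|ring].
    + apply (is_derive_minus (K := R_AbsRing) (V := R_NormedModule)).
      * apply (is_derive_Rmult (shift_conv Ai Ai x) f1); auto.
      * apply (is_derive_Rmult (shift_conv Ai Ai1 x) f); auto.
  - now apply (boundary_term_left s x f f1 f2).
  - now apply (boundary_term_infty s x f f1 f2).
Qed.

Definition real_L (s : R) (f f1 f2 : R -> R) (x : R) : R :=
  f1 x + (x - s) * f2 x - x * (x - s) * f x.

(** Convergence of the integral of k L f is a conclusion: k L f is written as the integrand of
    [is_RInt_gen_boundary] plus f L_x k, and the latter splits into three dominated integrals, which
    are K f and its derivatives in [x] up to coefficients. *)
Lemma is_RInt_gen_real_commute (s x : R) (f f1 f2 : R -> R) : real_admissible s f f1 f2 -> s < x ->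
  is_RInt_gen (fun y => shift_conv Ai Ai x y * real_L s f f1 f2 y)
    (at_right s) (Rbar_locally p_infty)
    (real_L s (shift_op s Ai f) (shift_op s Ai1 f) (shift_op s Ai2 f) x).
Proof.
  intros h hx.
  assert (i0 := is_RInt_gen_shift_op s x Ai f f1 f2 (decaying_Ai s) h hx).
  assert (i1 := is_RInt_gen_shift_op s x Ai1 f f1 f2 (decaying_Ai1 s) h hx).
  assert (i2 := is_RInt_gen_shift_op s x Ai2 f f1 f2 (decaying_Ai2 s) h hx).
  assert (ib := is_RInt_gen_boundary s x f f1 f2 h hx).
  assert (hs := is_RInt_gen_plus (V := R_NormedModule) _ _ _ _ ib
    (is_RInt_gen_minus (V := R_NormedModule) _ _ _ _
      (is_RInt_gen_plus (V := R_NormedModule) _ _ _ _ i1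
        (is_RInt_gen_scal (V := R_NormedModule) _ (x - s) _ i2))
      (is_RInt_gen_scal (V := R_NormedModule) _ (x * (x - s)) _ i0))).
  match type of hs with is_RInt_gen _ _ _ ?l =>
    replace (real_L s (shift_op s Ai f) (shift_op s Ai1 f) (shift_op s Ai2 f) x) with l end.
  2:{ unfold real_L, minus, plus, opp, scal; simpl. unfold mult; simpl. ring. }
  revert hs. apply (is_RInt_gen_half_ext (V := R_NormedModule)). intros y hys.
  assert (hL := shift_conv_L_symmetric s x y hx hys).
  unfold real_L, minus, plus, opp, scal; simpl. unfold mult; simpl.
  (* The two integrands differ by (L_x k - L_y k) f, that is, by the difference of the sides of [hL]
     times [f y]. *)
  match goal with |- ?l = ?r => apply (Rminus_diag_uniq l r) end.
  match type of hL with ?l = ?r => apply Rminus_diag_eq in hL;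
    transitivity ((l - r) * f y); [ring|rewrite hL; ring] end.
Qed.

(** * Complex-valued functions *)

Lemma is_RInt_gen_pair (Fa Fb : (R -> Prop) -> Prop) {FFa : Filter Fa} {FFb : Filter Fb}
  (g : R -> C) (l1 l2 : R) :
  is_RInt_gen (fun y => Re (g y)) Fa Fb l1 -> is_RInt_gen (fun y => Im (g y)) Fa Fb l2 ->
  is_RInt_gen (V := C_R_NormedModule) g Fa Fb (l1, l2).
Proof.
  intros h1 h2. apply (filterlimi_locally (U := C_R_NormedModule)). intros eps.
  generalize (filter_and _ _ (proj1 (filterlimi_locally (U := R_NormedModule) _ l1) h1 eps)
    (proj1 (filterlimi_locally (U := R_NormedModule) _ l2) h2 eps)).
  apply filter_imp. intros ab [[z1 [i1 b1]] [z2 [i2 b2]]].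
  exists (z1, z2). split.
  - now apply (is_RInt_fct_extend_pair (U := R_NormedModule) (V := R_NormedModule) g).
  - now split.
Qed.

Lemma is_derive_pair (w z : R -> R) (x l1 l2 : R) : is_derive w x l1 -> is_derive z x l2 ->
  is_derive (K := R_AbsRing) (V := C_R_NormedModule) (fun t => (w t, z t)) x (l1, l2).
Proof.
  intros hw hz.
  (* Writing a pair in the basis (1, 0), (0, 1) reduces its derivative to those of scalar functions
     times fixed vectors. *)
  assert (e : forall a b : R,
    plus (G := C_R_NormedModule) (scal a ((1, 0) : C_R_NormedModule)) (scal b ((0, 1) : C_R_NormedModule)) = (a, b)).
  { intros a b. unfold plus, scal; simpl. unfold prod_plus, prod_scal, plus, scal; simpl.
    unfold mult; simpl. f_equal; ring. }
  rewrite <- e.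
  apply (is_derive_ext (V := C_R_NormedModule)
    (fun t => plus (G := C_R_NormedModule) (scal (w t) ((1, 0) : C_R_NormedModule)) (scal (z t) ((0, 1) : C_R_NormedModule)))).
  { intros t. apply e. }
  apply (is_derive_plus (V := C_R_NormedModule)).
  - now apply (is_derive_scal_l (V := C_R_NormedModule) w).
  - now apply (is_derive_scal_l (V := C_R_NormedModule) z).
Qed.

Lemma is_derive_Re_Im (g : R -> C) (x : R) (l : C) :
  is_derive (K := R_AbsRing) (V := C_R_NormedModule) g x l ->
  is_derive (fun t => Re (g t)) x (Re l) /\ is_derive (fun t => Im (g t)) x (Im l).
Proof.
  intros h. split.
  - apply (filterdiff_comp' (K := R_AbsRing) (U := R_NormedModule) (V := C_R_NormedModule)
      (W := R_NormedModule) g (fun z : C => fst z) x (fun y => scal y l) (fun z : C => fst z)); [exact h|].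
    apply (filterdiff_linear (K := R_AbsRing) (U := C_R_NormedModule) (V := R_NormedModule)).
    apply (is_linear_fst (U := R_NormedModule) (V := R_NormedModule)).
  - apply (filterdiff_comp' (K := R_AbsRing) (U := R_NormedModule) (V := C_R_NormedModule)
      (W := R_NormedModule) g (fun z : C => snd z) x (fun y => scal y l) (fun z : C => snd z)); [exact h|].
    apply (filterdiff_linear (K := R_AbsRing) (U := C_R_NormedModule) (V := R_NormedModule)).
    apply (is_linear_snd (U := R_NormedModule) (V := R_NormedModule)).
Qed.

Lemma ex_deriveRC_Derive (g : R -> C) (x : R) : ex_deriveRC g x ->
  is_derive (fun t => Re (g t)) x (Derive (fun t => Re (g t)) x) /\
  is_derive (fun t => Im (g t)) x (Derive (fun t => Im (g t)) x).
Proof.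
  intros [l hl]. apply is_derive_Re_Im in hl. destruct hl as [h1 h2].
  split; apply Derive_correct; eexists; eassumption.
Qed.

Lemma filterlim_Re_Im (F : (R -> Prop) -> Prop) (g : R -> C) (l : C) :
  filterlim g F (locally (T := C_R_NormedModule) l) ->
  filterlim (fun t => Re (g t)) F (locally (Re l)) /\ filterlim (fun t => Im (g t)) F (locally (Im l)).
Proof.
  intros h. split.
  - apply (filterlim_comp _ _ _ g (fun z : C => fst z) _ _ _ h).
    apply (continuous_fst (U := R_UniformSpace) (V := R_UniformSpace)).
  - apply (filterlim_comp _ _ _ g (fun z : C => snd z) _ _ _ h).
    apply (continuous_snd (U := R_UniformSpace) (V := R_UniformSpace)).
Qed.

Lemma Re_Im_le_Cmod (z : C) : Rabs (Re z) <= Cmod z /\ Rabs (Im z) <= Cmod z.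
Proof.
  assert (h := Rmax_Cmod z).
  split; eapply Rle_trans; [apply Rmax_l|exact h|apply Rmax_r|exact h].
Qed.

Lemma admissible_Re (s : R) (f : R -> C) : admissible s f ->
  real_admissible s (fun t => Re (f t)) (Derive (fun t => Re (f t)))
    (Derive (Derive (fun t => Re (f t)))).
Proof.
  intros h. split.
  - intros y hy. exact (proj1 (ex_deriveRC_Derive _ _ (adm_derive1 _ _ h y hy))).
  - intros y hy. exact (proj1 (ex_deriveRC_Derive _ _ (adm_derive2 _ _ h y hy))).
  - intros y hy. exact (proj1 (filterlim_Re_Im _ _ _ (adm_continuous2 _ _ h y hy))).
  - assert (hl := proj1 (filterlim_Re_Im _ _ _ (adm_left _ _ h))). revert hl.
    apply filterlim_ext. intros y. simpl. ring.
  - destruct (adm_infty _ _ h) as [a [M H]]. exists a, M. revert H. apply filter_imp.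
    intros y [h1 h2]. split.
    + exact (Rle_trans _ _ _ (proj1 (Re_Im_le_Cmod (f y))) h1).
    + exact (Rle_trans _ _ _ (proj1 (Re_Im_le_Cmod (DeriveRC f y))) h2).
Qed.

Lemma admissible_Im (s : R) (f : R -> C) : admissible s f ->
  real_admissible s (fun t => Im (f t)) (Derive (fun t => Im (f t)))
    (Derive (Derive (fun t => Im (f t)))).
Proof.
  intros h. split.
  - intros y hy. exact (proj2 (ex_deriveRC_Derive _ _ (adm_derive1 _ _ h y hy))).
  - intros y hy. exact (proj2 (ex_deriveRC_Derive _ _ (adm_derive2 _ _ h y hy))).
  - intros y hy. exact (proj2 (filterlim_Re_Im _ _ _ (adm_continuous2 _ _ h y hy))).
  - assert (hl := proj2 (filterlim_Re_Im _ _ _ (adm_left _ _ h))). revert hl.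
    apply filterlim_ext. intros y. simpl. ring.
  - destruct (adm_infty _ _ h) as [a [M H]]. exists a, M. revert H. apply filter_imp.
    intros y [h1 h2]. split.
    + exact (Rle_trans _ _ _ (proj2 (Re_Im_le_Cmod (f y))) h1).
    + exact (Rle_trans _ _ _ (proj2 (Re_Im_le_Cmod (DeriveRC f y))) h2).
Qed.

Lemma locally_gt (s x : R) : s < x -> locally x (fun t => s < t).
Proof.
  intros hx. assert (h : 0 < x - s) by lra. exists (mkposreal _ h). intros z hz.
  apply (Rabs_lt_ball s x z hz).
Qed.

Lemma DeriveRC_pair (s : R) (g : R -> C) (w z w1 z1 : R -> R) :
  (forall t, s < t -> g t = (w t, z t)) -> derives s w w1 -> derives s z z1 ->
  forall t, s < t -> DeriveRC g t = (w1 t, z1 t).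
Proof.
  intros hg dw dz t ht. unfold DeriveRC. f_equal; apply is_derive_unique.
  - apply (is_derive_ext_loc w); [|now apply dw].
    apply (filter_imp _ _) with (2 := locally_gt s t ht). intros y hy. now rewrite (hg y hy).
  - apply (is_derive_ext_loc z); [|now apply dz].
    apply (filter_imp _ _) with (2 := locally_gt s t ht). intros y hy. now rewrite (hg y hy).
Qed.

Lemma ex_deriveRC_pair (s : R) (g : R -> C) (w z w1 z1 : R -> R) (x : R) :
  (forall t, s < t -> g t = (w t, z t)) -> derives s w w1 -> derives s z z1 -> s < x ->
  ex_deriveRC g x.
Proof.
  intros hg dw dz hx. exists (w1 x, z1 x).
  apply (is_derive_ext_loc (V := C_R_NormedModule) (fun t => (w t, z t))).
  - apply (filter_imp _ _) with (2 := locally_gt s x hx). intros y hy. now rewrite (hg y hy).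
  - apply is_derive_pair; [now apply dw|now apply dz].
Qed.

Lemma airy_diff_op_pair (s : R) (g : R -> C) (w z w1 z1 w2 z2 : R -> R) (x : R) :
  (forall t, s < t -> g t = (w t, z t)) -> derives s w w1 -> derives s z z1 ->
  derives s w1 w2 -> derives s z1 z2 -> s < x ->
  airy_diff_op s g x = (real_L s w w1 w2 x, real_L s z z1 z2 x).
Proof.
  intros hg dw dz dw1 dz1 hx. unfold airy_diff_op.
  assert (hd : forall a a1, derives s a a1 -> derives s (fun t => (t - s) * a t) (fun t => 1 * a t + (t - s) * a1 t)).
  { intros a a1 ha t ht. apply (is_derive_Rmult (fun t => t - s) a); [|now apply ha].
    auto_derive; [easy|ring]. }
  rewrite (DeriveRC_pair s (fun t => (RtoC (t - s) * DeriveRC g t)%C)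
    (fun t => (t - s) * w1 t) (fun t => (t - s) * z1 t)
    (fun t => 1 * w1 t + (t - s) * w2 t) (fun t => 1 * z1 t + (t - s) * z2 t)); auto.
  - rewrite (hg x hx). unfold real_L, Cminus, Cplus, Copp, Cmult, RtoC; simpl. f_equal; ring.
  - intros t ht. rewrite (DeriveRC_pair s g w z w1 z1) by assumption.
    unfold Cmult, RtoC; simpl. f_equal; ring.
Qed.

Lemma airyA_Derive (mu : C) (y : R) : DeriveRC (airyA mu) y = (mu * RtoC (Ai1 y))%C.
Proof.
  (* [y - 1] is an arbitrary left endpoint that puts [y] inside the half-line. *)
  rewrite (DeriveRC_pair (y - 1) (airyA mu) (fun t => Re mu * Ai t) (fun t => Im mu * Ai t)
    (fun t => Re mu * Ai1 t) (fun t => Im mu * Ai1 t)); try lra.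
  - unfold Cmult, RtoC, Re, Im; simpl. f_equal; ring.
  - intros t _. unfold airyA, Cmult, RtoC, Re, Im; simpl. f_equal; ring.
  - intros t _. apply is_derive_scal, is_derive_Ai.
  - intros t _. apply is_derive_scal, is_derive_Ai.
Qed.

Lemma airy_quotient_off_diagonal (mu : C) (x y : R) : x <> y ->
  airy_quotient mu x y = (mu * mu * RtoC (shift_conv Ai Ai x y))%C.
Proof.
  intros hxy. unfold airy_quotient. rewrite !airyA_Derive. unfold airyA.
  assert (h : (RtoC (x - y) * RtoC (shift_conv Ai Ai x y))%C
    = (RtoC (Ai x) * RtoC (Ai1 y) - RtoC (Ai1 x) * RtoC (Ai y))%C).
  { rewrite <- !RtoC_mult, <- RtoC_minus. f_equal. apply shift_conv_Ai_Ai. }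
  assert (h0 : RtoC (x - y) <> 0%C).
  { intros e. apply RtoC_inj in e. lra. }
  transitivity (mu * mu * (RtoC (x - y) * RtoC (shift_conv Ai Ai x y)) / RtoC (x - y))%C.
  - rewrite h. field. exact h0.
  - field. exact h0.
Qed.

(** On the diagonal the Wronskian identity cannot be divided by x - y. Instead [shift_conv Ai Ai x]
    is continuous at [x] and agrees with the quotient, up to the factor [mu * mu], on the punctured
    neighbourhood over which the limit is taken. *)
Lemma airy_kernel_shift_conv (mu : C) (x y : R) :
  airy_kernel mu x y = (mu * mu * RtoC (shift_conv Ai Ai x y))%C.
Proof.
  unfold airy_kernel. destruct (Req_EM_T x y) as [<-|hxy]; [|now apply airy_quotient_off_diagonal].
  assert (hl : forall m : R, is_lim (fun z => m * shift_conv Ai Ai x z) x (m * shift_conv Ai Ai x x)).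
  { intros m. apply (is_lim_continuity (fun z => m * shift_conv Ai Ai x z)).
    apply continuity_pt_filterlim. apply (Rmult_continuous (fun _ => m)); [apply continuous_const|].
    refine (is_derive_continuous _ _ _
      (is_derive_shift_conv_r (x - 1) Ai Ai Ai1 Ai2 x x _ _ _ _ _ _ _ _));
      auto using decaying_Ai, decaying_Ai1, decaying_Ai2, derives_Ai, derives_Ai1; lra. }
  assert (hq : forall z, z <> x ->
    Re (mu * mu) * shift_conv Ai Ai x z = Re (airy_quotient mu x z) /\
    Im (mu * mu) * shift_conv Ai Ai x z = Im (airy_quotient mu x z)).
  { intros z hz. rewrite airy_quotient_off_diagonal by (intros e; now apply hz).
    split; unfold Re, Im, Cmult, RtoC; simpl; ring. }
  assert (hloc : forall P : R -> Prop, (forall z, z <> x -> P z) -> Rbar_locally' x P).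
  { intros P hP. exists (mkposreal 1 Rlt_0_1). intros z _ hz. now apply hP. }
  unfold LimRC.
  rewrite (is_lim_unique _ _ (Re (mu * mu) * shift_conv Ai Ai x x)),
    (is_lim_unique _ _ (Im (mu * mu) * shift_conv Ai Ai x x)).
  - unfold Re, Im, Cmult, RtoC; simpl. f_equal; ring.
  - apply (is_lim_ext_loc (fun z => Im (mu * mu) * shift_conv Ai Ai x z)); [|apply hl].
    apply hloc. intros z hz. now apply hq.
  - apply (is_lim_ext_loc (fun z => Re (mu * mu) * shift_conv Ai Ai x z)); [|apply hl].
    apply hloc. intros z hz. now apply hq.
Qed.

Lemma is_RInt_gen_airy_kernel (s x : R) (mu : C) (g : R -> C) (w z : R -> R) (lw lz : R) :
  (forall y, s < y -> g y = (w y, z y)) ->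
  is_RInt_gen (fun y => shift_conv Ai Ai x y * w y) (at_right s) (Rbar_locally p_infty) lw ->
  is_RInt_gen (fun y => shift_conv Ai Ai x y * z y) (at_right s) (Rbar_locally p_infty) lz ->
  is_RInt_gen (V := C_R_NormedModule) (fun y => (airy_kernel mu x y * g y)%C)
    (at_right s) (Rbar_locally p_infty) (mu * mu * (lw, lz))%C.
Proof.
  intros hg hw hz.
  set (p := Re (mu * mu)). set (q := Im (mu * mu)).
  apply (is_RInt_gen_half_ext s (V := C_R_NormedModule)
    (fun y => (p * (shift_conv Ai Ai x y * w y) - q * (shift_conv Ai Ai x y * z y),
               p * (shift_conv Ai Ai x y * z y) + q * (shift_conv Ai Ai x y * w y)))).
  - intros y hy. rewrite airy_kernel_shift_conv, (hg y hy).
    unfold p, q, Re, Im, Cmult, RtoC; simpl. f_equal; ring.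
  - replace (mu * mu * (lw, lz))%C with (p * lw - q * lz, p * lz + q * lw)
      by (unfold p, q, Re, Im, Cmult; simpl; f_equal; ring).
    refine (is_RInt_gen_pair _ _ _ _ _ _ _).
    + exact (is_RInt_gen_minus (V := R_NormedModule) _ _ _ _
        (is_RInt_gen_scal (V := R_NormedModule) _ p _ hw)
        (is_RInt_gen_scal (V := R_NormedModule) _ q _ hz)).
    + exact (is_RInt_gen_plus (V := R_NormedModule) _ _ _ _
        (is_RInt_gen_scal (V := R_NormedModule) _ p _ hz)
        (is_RInt_gen_scal (V := R_NormedModule) _ q _ hw)).
Qed.

Lemma derives_linear (s p q : R) (a a1 b b1 : R -> R) : derives s a a1 -> derives s b b1 ->
  derives s (fun t => p * a t + q * b t) (fun t => p * a1 t + q * b1 t).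
Proof.
  intros ha hb x hx. apply (is_derive_plus (K := R_AbsRing) (V := R_NormedModule)).
  - apply is_derive_scal. now apply ha.
  - apply is_derive_scal. now apply hb.
Qed.

Theorem mainTheorem5 (s : R) (lambda sqrt_lambda : C)
  (hsqrt : (sqrt_lambda * sqrt_lambda)%C = lambda)
  (f : R -> C) (hf : admissible s f) (x : R) (hx : (s < x)%R) :
  (* K f is defined, and L applies to it *)
  ex_int_half_line s (fun y => (airy_kernel sqrt_lambda x y * f y)%C) /\
  ex_deriveRC (airy_op s sqrt_lambda f) x /\
  ex_deriveRC (DeriveRC (airy_op s sqrt_lambda f)) x /\
  (* K (L f) is defined *)
  ex_int_half_line s
    (fun y => (airy_kernel sqrt_lambda x y * airy_diff_op s f y)%C) /\
  (* K L f = L K f *)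
  airy_op s sqrt_lambda (airy_diff_op s f) x
    = airy_diff_op s (airy_op s sqrt_lambda f) x.
Proof.
  assert (hu := admissible_Re s f hf). assert (hv := admissible_Im s f hf).
  set (u := fun t => Re (f t)) in *. set (v := fun t => Im (f t)) in *.
  set (u1 := Derive u) in *. set (v1 := Derive v) in *.
  set (u2 := Derive u1) in *. set (v2 := Derive v1) in *.
  assert (hfp : forall t, s < t -> f t = (u t, v t)).
  { intros t _. unfold u, v, Re, Im. now destruct (f t). }
  assert (hLf : forall t, s < t -> airy_diff_op s f t = (real_L s u u1 u2 t, real_L s v v1 v2 t)).
  { intros t ht. apply airy_diff_op_pair; try assumption; first [apply hu|apply hv]. }
  assert (iK : forall t, s < t ->
    is_RInt_gen (V := C_R_NormedModule) (fun y => (airy_kernel sqrt_lambda t y * f y)%C)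
      (at_right s) (Rbar_locally p_infty)
      (sqrt_lambda * sqrt_lambda * (shift_op s Ai u t, shift_op s Ai v t))%C).
  { intros t ht. apply (is_RInt_gen_airy_kernel s t sqrt_lambda f u v); [exact hfp| |].
    - exact (is_RInt_gen_shift_op s t Ai u u1 u2 (decaying_Ai s) hu ht).
    - exact (is_RInt_gen_shift_op s t Ai v v1 v2 (decaying_Ai s) hv ht). }
  assert (iKL := is_RInt_gen_airy_kernel s x sqrt_lambda (airy_diff_op s f) _ _ _ _ hLf
    (is_RInt_gen_real_commute s x u u1 u2 hu hx) (is_RInt_gen_real_commute s x v v1 v2 hv hx)).
  (* Only the square of [sqrt_lambda] enters, so both roots of lambda give the same operator. *)
  rewrite hsqrt in iK, iKL.
  set (p := Re lambda). set (q := Im lambda).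
  assert (hK : forall t, s < t -> airy_op s sqrt_lambda f t
    = (p * shift_op s Ai u t + - q * shift_op s Ai v t,
       p * shift_op s Ai v t + q * shift_op s Ai u t)).
  { intros t ht.
    etransitivity; [exact (is_RInt_gen_unique (V := C_R_CompleteNormedModule) _ _ (iK t ht))|].
    unfold p, q, Re, Im, Cmult; simpl. f_equal; ring. }
  assert (du : derives s (shift_op s Ai u) (shift_op s Ai1 u)).
  { intros t ht. exact (is_derive_shift_op_Ai s t u u1 u2 hu ht). }
  assert (dv : derives s (shift_op s Ai v) (shift_op s Ai1 v)).
  { intros t ht. exact (is_derive_shift_op_Ai s t v v1 v2 hv ht). }
  assert (du1 : derives s (shift_op s Ai1 u) (shift_op s Ai2 u)).
  { intros t ht. exact (is_derive_shift_op_Ai1 s t u u1 u2 hu ht). }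
  assert (dv1 : derives s (shift_op s Ai1 v) (shift_op s Ai2 v)).
  { intros t ht. exact (is_derive_shift_op_Ai1 s t v v1 v2 hv ht). }
  assert (dre := derives_linear s p (- q) _ _ _ _ du dv).
  assert (dim := derives_linear s p q _ _ _ _ dv du).
  assert (dre1 := derives_linear s p (- q) _ _ _ _ du1 dv1).
  assert (dim1 := derives_linear s p q _ _ _ _ dv1 du1).
  split; [eexists; exact (iK x hx)|].
  split; [exact (ex_deriveRC_pair s _ _ _ _ _ x hK dre dim hx)|].
  split; [exact (ex_deriveRC_pair s _ _ _ _ _ x (DeriveRC_pair s _ _ _ _ _ hK dre dim) dre1 dim1 hx)|].
  split; [eexists; exact iKL|].
  (* Multiplication by lambda mixes real and imaginary parts with the constant coefficients [p] and
     [q], and [real_L] is linear; both sides thus become lambda times the same pair. *)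
  rewrite (airy_diff_op_pair s _ _ _ _ _ _ _ x hK dre dim dre1 dim1 hx).
  etransitivity; [exact (is_RInt_gen_unique (V := C_R_CompleteNormedModule) _ _ iKL)|].
  unfold real_L, p, q, Re, Im, Cmult; simpl. f_equal; ring.
Qed.
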